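(* Let $k$ be an infinite field of characteristic $p \ge 0$, let $W$ be a representation of a group $G$ over $k$, let $S = \mathrm{Sym}(W \otimes \mathbf{V})$ (a $\mathbf{GL}$-algebra on which $G$ acts through $W$), and let $R = T(W)$ (a twisted commutative algebra on which $G$ acts through $W$). Let $\mathcal{S}$ be the Schur functor. Under the identification $\mathcal{S}(S) \cong R$ of twisted commutative algebras described in the context: (1) we have an isomorphism $\mathcal{S}(S^G) \cong R^G$; and (2) given a $\mathbf{GL}$-subrepresentation $U \subset S^G$ that generates $S^G$ (as a $k$-algebra), the subspace $\mathcal{S}(U) \subset R^G$ generates $R^G$ (as a twisted commutative algebra).
   Context: $\mathbf{V}$ is the $k$-vector space with basis $e_1, e_2, \ldots$ and $\mathbf{GL}$ is the group of $k$-linear automorphisms of $\mathbf{V}$. A representation of $\mathbf{GL}$ is polynomial if it is a subquotient of a direct sum of representations $\mathbf{V}^{\otimes n}$ ($n$ may vary); these form a symmetric monoidal category $\mathrm{Rep}^{\mathrm{pol}}(\mathbf{GL})$ with the usual tensor product and braiding. A $\mathbf{GL}$-algebra is a commutative algebra object in it, i.e. a commutative $k$-algebra with an action of $\mathbf{GL}$ by algebra automorphisms that is a polynomial representation. In $S = \mathrm{Sym}(W \otimes \mathbf{V})$, $\mathbf{GL}$ acts through $\mathbf{V}$ and $G$ through $W$. An $\mathfrak{S}_*$-representation is a sequence $\{V_n\}_{n \in \mathbf{N}}$ with $V_n$ a $k$-representation of the symmetric group $\mathfrak{S}_n$; these form a symmetric monoidal category $\mathrm{Rep}(\mathfrak{S}_*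 )$ with $(V \boxtimes V')_n = \bigoplus_{i=0}^n \mathrm{Ind}_{\mathfrak{S}_i \times \mathfrak{S}_{n-i}}^{\mathfrak{S}_n} (V_i \otimes V'_{n-i})$. A twisted commutative algebra (tca) is a commutative algebra object in $\mathrm{Rep}(\mathfrak{S}_* )$: an associative unital $\mathbf{N}$-graded $k$-algebra $A$ with $\mathfrak{S}_n$ acting on $A_n$, such that multiplication $A_n \otimes A_m \to A_{n+m}$ is $(\mathfrak{S}_n \times \mathfrak{S}_m)$-equivariant and $xy = \tau_{m,n}(yx)$ for $x \in A_n$, $y \in A_m$, where $\tau_{m,n}(i) = i+n$ for $1 \le i \le m$ and $\tau_{m,n}(i) = i-m$ for $m+1 \le i \le n+m$. The tensor algebra $T(W)$ is a tca with $\sigma(w_1 \cdots w_n) = w_{\sigma^{-1}(1)} \cdots w_{\sigma^{-1}(n)}$; $G$ acts on it by tca automorphisms (diagonally on $W^{\otimes n}$), so $T(W)^G$ is a tca. A subset generates a tca if the smallest subspace containing it (and the unit) and stable under multiplication and the symmetric group actions is the whole tca. The Schur functor $\mathcal{S} : \mathrm{Rep}^{\mathrm{pol}}(\mathbf{GL}) \to \mathrm{Rep}(\mathfrak{S}_* )$ is $\mathcal{S}(U) = \{\mathrm{Hom}_{\mathbf{GL}}(\mathbf{V}^{\otimes n}, U)\}_{n}$. Via $f \mapsto f(e_1 \otimes \cdots \otimes e_n)$, $\mathcal{S}(U)_n$ is identified with the weight space of $U$ of weight $(1^n) = (1,\ldots,1,0,0,\ldots)$, with $\mathfrak{S}_n$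 acting by permutation of $e_1,\dots,e_n$. $\mathcal{S}$ is symmetric monoidal, so it takes $\mathbf{GL}$-algebras to tcas (the product of $f \in \mathcal{S}(A)_d$ and $g \in \mathcal{S}(A)_e$ is the map sending $v_1 \otimes \cdots \otimes v_{d+e}$ to $f(v_1 \otimes \cdots \otimes v_d)\, g(v_{d+1} \otimes \cdots \otimes v_{d+e})$). The identification $\mathcal{S}(S) \cong R$ matches the weight vector $(w_1 \otimes e_1)(w_2 \otimes e_2) \cdots (w_n \otimes e_n) \in S$ with $w_1 w_2 \cdots w_n \in T(W)_n$. *)

(* Defs.v *)
From HB Require Import structures.
From mathcomp Require Import all_boot all_algebra all_fingroup generic_quotient.
From mathcomp Require Import boolp classical_sets functions cardinality.
From mathcomp Require Import finmap monalg.

Set Implicit Arguments.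
Unset Strict Implicit.
Unset Printing Implicit Defensive.

Import GRing.Theory.
Local Open Scope ring_scope.
Local Open Scope quotient_scope.

(* The operations of the quotients below are locked, since unification must not
   unfold them down to computations with representatives. *)
Fact quot_key : unit. Proof. by []. Qed.

Section Span.
Variables (k : fieldType) (M : lmodType k) (X : M -> Prop).

Inductive span : M -> Prop :=
| span_in x : X x -> span x
| span_0 : span 0
| span_lin a x y : span x -> span y -> span (a *: x + y).

Lemma spanD x y : span x -> span y -> span (x + y).
Proof. by move=> sx sy; rewrite -[x]scale1r; apply: span_lin. Qed.

Lemma spanZ a x : span x -> span (a *: x).
Proof. by move=> sx; rewrite -[_ *: _]addr0; apply: span_lin => //; apply: span_0. Qed.

Lemma spanN x : span x -> span (- x).
Proof. by move=> sx; rewrite -scaleN1r; apply: spanZ. Qed.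

Lemma spanB x y : span x -> span y -> span (x - y).
Proof. by move=> sx sy; apply: spanD => //; apply: spanN. Qed.

Definition qrel (x y : M) : bool := `[< span (x - y) >].

Lemma qrel_equiv : equiv_class_of qrel.
Proof.
split.
- by move=> x; apply/asboolP; rewrite subrr; apply: span_0.
- by move=> x y; apply/asboolP/asboolP => /spanN; rewrite opprB.
- move=> y x z /asboolP xy /asboolP yz; apply/asboolP.
  by rewrite -(subrKA y); apply: spanD.
Qed.

Canonical qrel_equivrel := EquivRelPack qrel_equiv.
Canonical qrel_encmod := defaultEncModRel qrel.

Definition qmod := {eq_quot qrel}.
HB.instance Definition _ := Choice.on qmod.
HB.instance Definition _ := EqQuotient.on qmod.

Definition qpi (x : M) : qmod := locked_with quot_key (\pi_qmod x).

Lemma qpiP x y : qpi x = qpi y <-> span (x - y).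
Proof.
rewrite /qpi !locked_withE; split => [/eqquotP/asboolP //|h].
by apply/eqquotP/asboolP.
Qed.

Lemma qpi_repr (u : qmod) : qpi (repr u) = u.
Proof. by rewrite /qpi locked_withE reprK. Qed.

Lemma qpi_surj (u : qmod) : exists x, u = qpi x.
Proof. by exists (repr u); rewrite qpi_repr. Qed.

Let qadd (u v : qmod) := locked_with quot_key (qpi (repr u + repr v)).
Let qopp (u : qmod) := locked_with quot_key (qpi (- repr u)).
Let qscale a (u : qmod) := locked_with quot_key (qpi (a *: repr u)).

Let qaddE x y : qadd (qpi x) (qpi y) = qpi (x + y).
Proof.
rewrite /qadd locked_withE; apply/qpiP; rewrite opprD addrACA.
by apply: spanD; apply/qpiP; rewrite qpi_repr.
Qed.

Let qoppE x : qopp (qpi x) = qpi (- x).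
Proof. by rewrite /qopp locked_withE; apply/qpiP; rewrite -opprD; apply/spanN/qpiP; rewrite qpi_repr. Qed.

Let qscaleE a x : qscale a (qpi x) = qpi (a *: x).
Proof. by rewrite /qscale locked_withE; apply/qpiP; rewrite -scalerBr; apply/spanZ/qpiP; rewrite qpi_repr. Qed.

Let qaddA : associative qadd.
Proof.
move=> u v w; have [[x ->] [y ->] [z ->]] := And3 (qpi_surj u) (qpi_surj v) (qpi_surj w).
by rewrite !qaddE addrA.
Qed.
Let qaddC : commutative qadd.
Proof. by move=> u v; rewrite /qadd (addrC (repr u)). Qed.
Let qadd0 : left_id (qpi 0) qadd.
Proof. by move=> u; have [x ->] := qpi_surj u; rewrite qaddE add0r. Qed.
Let qaddN : left_inverse (qpi 0) qopp qadd.
Proof. by move=> u; have [x ->] := qpi_surj u; rewrite qoppE qaddE addNr. Qed.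

HB.instance Definition _ := GRing.isZmodule.Build qmod qaddA qaddC qadd0 qaddN.

Let qscaleA a b (u : qmod) : qscale a (qscale b u) = qscale (a * b) u.
Proof. by have [x ->] := qpi_surj u; rewrite !qscaleE scalerA. Qed.
Let qscale1 : left_id 1 qscale.
Proof. by move=> u; have [x ->] := qpi_surj u; rewrite !qscaleE scale1r. Qed.
Let qscaleDr : right_distributive qscale +%R.
Proof.
move=> a u v; have [x ->] := qpi_surj u; have [y ->] := qpi_surj v.
by rewrite /GRing.add /= !(qscaleE, qaddE) scalerDr.
Qed.
Let qscaleDl u : {morph qscale^~ u : a b / a + b}.
Proof.
move=> a b; have [x ->] := qpi_surj u.
by rewrite /GRing.add /= !(qscaleE, qaddE) scalerDl.
Qed.

HB.instance Definition _ :=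
  GRing.Zmodule_isLmodule.Build k qmod qscaleA qscale1 qscaleDr qscaleDl.

Lemma qpi_is_linear : linear qpi.
Proof. by move=> a x y; rewrite /GRing.scale /GRing.add /= qscaleE qaddE. Qed.
HB.instance Definition _ := GRing.isLinear.Build k M qmod *:%R qpi qpi_is_linear.

Lemma qpi_eq0 x : X x -> qpi x = 0.
Proof.
move=> Xx; rewrite -(linear0 qpi); apply/qpiP.
by rewrite subr0; apply: span_in.
Qed.

Section Lift.
Variables (N : lmodType k) (f : {linear M -> N}).

Definition qlift (u : qmod) : N := locked_with quot_key (f (repr u)).

Hypothesis fX : forall x, X x -> f x = 0.

Lemma qliftE x : qlift (qpi x) = f x.
Proof.
suff span0 z : span z -> f z = 0.
  rewrite /qlift locked_withE; apply/eqP; rewrite -subr_eq0 -linearB; apply/eqP/span0/qpiP.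
  exact: qpi_repr.
elim=> [{}z|//|a x' y' _ IHx _ IHy]; [exact: fX|exact: linear0|].
by rewrite linearP IHx IHy scaler0 addr0.
Qed.

Lemma qlift_is_linear : linear qlift.
Proof.
move=> a u v; have [x ->] := qpi_surj u; have [y ->] := qpi_surj v.
by rewrite -linearP !qliftE linearP.
Qed.

End Lift.
End Span.

(* {malg k[I]} is the free k-module on the set I; fbase is its basis *)
Definition fbase (k : fieldType) (I : choiceType) (i : I) : {malg k[I]} :=
  locked_with quot_key << i >>.
Arguments fbase k {I} i.

Section Free.
Variables (k : fieldType) (I : choiceType) (N : lmodType k).

Definition flift (h : I -> N) (g : {malg k[I]}) : N :=
  locked_with quot_key (\sum_(i <- msupp g) g@_i *: h i).

Variable h : I -> N.

Lemma fliftEw (d : {fset I}) (g : {malg k[I]}) : {subset msupp g <= d} ->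
  flift h g = \sum_(i <- d) g@_i *: h i.
Proof.
move=> /fsubsetP sgd; rewrite /flift locked_withE -(big_fset_incl _ sgd) //= => i _ /mcoeff_outdom ->.
by rewrite scale0r.
Qed.

Lemma flift_is_linear : linear (flift h).
Proof.
move=> a x y; pose d := (msupp x `|` msupp y)%fset.
have sx : {subset msupp x <= d} by move=> i ix; rewrite inE ix.
have sy : {subset msupp y <= d} by move=> i iy; rewrite inE iy orbT.
have sxy : {subset msupp (a *: x + y) <= d}.
  move=> i; rewrite -mcoeff_neq0 mcoeffD mcoeffZ inE -!mcoeff_neq0.
  by apply: contra_neqT; rewrite negb_or !negbK => /andP[/eqP -> /eqP ->]; rewrite mulr0 addr0.
rewrite !(fliftEw sx, fliftEw sy, fliftEw sxy) scaler_sumr -big_split /=.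
by apply: eq_bigr => i _; rewrite mcoeffD mcoeffZ scalerDl scalerA.
Qed.
HB.instance Definition _ :=
  GRing.isLinear.Build k {malg k[I]} N *:%R (flift h) flift_is_linear.

Lemma fliftU i : flift h (fbase k i) = h i.
Proof.
by rewrite /flift /fbase !locked_withE msuppU oner_eq0 big_seq_fset1 mcoeffUU scale1r.
Qed.

End Free.

Lemma fbaseZ (k : fieldType) (I : choiceType) (a : k) (i : I) :
  << a *g i >> = a *: fbase k i.
Proof.
by apply/malgP => j; rewrite /fbase locked_withE mcoeffZ !mcoeffU mulrnAr mulr1.
Qed.

Lemma free_ext (k : fieldType) (I : choiceType) (N : lmodType k)
    (f g : {malg k[I]} -> N) :
  linear f -> linear g -> (forall i, f (fbase k i) = g (fbase k i)) -> f =1 g.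
Proof.
move=> lf lg fg x.
pose f' : {linear _ -> _} := HB.pack f (GRing.isLinear.Build _ _ _ _ f lf).
pose g' : {linear _ -> _} := HB.pack g (GRing.isLinear.Build _ _ _ _ g lg).
rewrite -[f x]/(f' x) -[g x]/(g' x) [x]monalgE !linear_sum; apply: eq_bigr => i _.
by rewrite fbaseZ !linearZ /= fg.
Qed.

Lemma fbaseM (k : fieldType) (K : conomType) (m n : K) :
  fbase k m * fbase k n = fbase k (mmul m n).
Proof.
rewrite /fbase !locked_withE (malgM_def << m >>) (@fgmulUU _ _ 1 1).
by rewrite mulr1.
Qed.

Lemma cmonom_ind (I : choiceType) (P : {cmonom I} -> Prop) :
  P mone -> (forall x m, P m -> P (mmul (ucm x) m)) -> forall m, P m.
Proof.
move=> P1 PM m; have [n] := ubnP (mdeg m); elim: n m => // n IHn m lt_mn.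
have [m0|[x xm]] := fset_0Vmem (finsupp m).
  suff -> : m = mone by [].
  by apply/eqP/cmP => i; rewrite cm1; apply/eqP; rewrite cmE_eq0 m0 inE.
have mE : m = mmul (ucm x) (divcm m (ucm x)).
  apply/eqP/cmP => i; rewrite cmM divcmE cmU subnKC //.
  by case: eqP => // <-; rewrite lt0n cmE_neq0.
rewrite mE; apply/PM/IHn.
by move: lt_mn; rewrite {1}mE mdegM mdegU ltnS.
Qed.

Section Sym.
Variables (k : fieldType) (M : lmodType k).

Notation freecom := {malg k[{cmonom M}]}.

Definition sym_var (x : M) : freecom := fbase k (ucm x).

(* spanning elements of the ideal that makes sym_var linear: Sym(M) is the free
   commutative algebra on the set M modulo this ideal *)
Inductive sym_rel : freecom -> Prop :=
  SymRel p a x y :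
    sym_rel (p * (sym_var (a *: x + y) - (a *: sym_var x + sym_var y))).

Definition sym := qmod sym_rel.
HB.instance Definition _ := GRing.Lmodule.on sym.

Let pi : {linear freecom -> sym} := qpi sym_rel.

Let mulZl a (p q : freecom) : (a *: p) * q = a *: (p * q).
Proof. by rewrite scalerAl. Qed.

Let mulZr a (p q : freecom) : p * (a *: q) = a *: (p * q).
Proof. by rewrite mulrC mulZl mulrC. Qed.

Let span_mul (p q : freecom) : span sym_rel q -> span sym_rel (p * q).
Proof.
elim=> [_ [r a x y]||a x y _ IHx _ IHy].
- by rewrite mulrA; apply/span_in/SymRel.
- by rewrite mulr0; apply: span_0.
- by rewrite mulrDr mulZr; exact: (span_lin _ IHx IHy).
Qed.

Let coef1_mulB a (r u v w : freecom) : u@_(@mone {cmonom M}) = 0 ->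
  v@_(@mone {cmonom M}) = 0 -> w@_(@mone {cmonom M}) = 0 ->
  (r * (u - (a *: v + w)))@_(@mone {cmonom M}) = 0.
Proof.
move=> u0 v0 w0; have [mM _] := @mcoeff1g_is_multiplicative {cmonom M} k.
by rewrite mM mcoeffB mcoeffD mcoeffZ u0 v0 w0 mulr0 addr0 subr0 mulr0.
Qed.

Let span_coef1 (q : freecom) : span sym_rel q -> q@_(@mone {cmonom M}) = 0.
Proof.
elim=> [_ [r a x y]||a x y _ IHx _ IHy].
- have c1 z : (sym_var z)@_(@mone {cmonom M}) = 0.
    rewrite /sym_var /fbase locked_withE mcoeffU; case: eqP => // /(congr1 (fun m : {cmonom M} => m z)).
    by rewrite cmUU cm1.
  apply: coef1_mulB; exact: c1.
- exact: mcoeff0.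
- by rewrite mcoeffD mcoeffZ IHx IHy mulr0 addr0.
Qed.

Let pi_surj (u : sym) : exists p : freecom, u = pi p.
Proof. exact: qpi_surj. Qed.

Let piZ a (p : freecom) : pi (a *: p) = a *: pi p.
Proof. by rewrite linearZ. Qed.

Let one : sym := locked_with quot_key (pi 1).
Let mul (u v : sym) : sym := locked_with quot_key (pi (repr u * repr v)).

Let mulE (p q : freecom) : mul (pi p) (pi q) = pi (p * q).
Proof.
rewrite /mul locked_withE; apply/qpiP; set p' := repr _; set q' := repr _.
have -> : p' * q' - p * q = p' * (q' - q) + q * (p' - p).
  by rewrite !mulrBr (mulrC q p') (mulrC q p) subrKA.
by apply: spanD; apply/span_mul/qpiP; rewrite qpi_repr.
Qed.

Let mulA : associative mul.
Proof.
move=> u v w.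
have [[p ->] [q ->] [r ->]] := And3 (pi_surj u) (pi_surj v) (pi_surj w).
by rewrite (mulE q r) (mulE p q) (mulE p) (mulE _ r) mulrA.
Qed.
Let mulC : commutative mul.
Proof. by move=> u v; rewrite /mul (mulrC (repr u : freecom)). Qed.
Let mul1 : left_id one mul.
Proof. by move=> u; have [p ->] := pi_surj u; rewrite /one locked_withE mulE mul1r. Qed.
Let mulDl : left_distributive mul +%R.
Proof.
move=> u v w.
have [[p ->] [q ->] [r ->]] := And3 (pi_surj u) (pi_surj v) (pi_surj w).
rewrite (mulE p r) (mulE q r) -(linearD pi) (mulE _ r).
by rewrite -(linearD pi) mulrDl.
Qed.
Let one_neq0 : one != 0.
Proof.
rewrite -(linear0 (qpi sym_rel)) /one locked_withE; apply/eqP => /qpiP/span_coef1.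
by rewrite subr0 mcoeffU1 eqxx => /eqP; rewrite oner_eq0.
Qed.

HB.instance Definition _ :=
  GRing.Zmodule_isComNzRing.Build sym mulA mulC mul1 mulDl one_neq0.

Lemma sym_piM (p q : freecom) : pi (p * q) = pi p * pi q.
Proof. by symmetry; exact: (mulE p q). Qed.

Let scaleAl a (u v : sym) : a *: (u * v) = (a *: u) * v.
Proof.
have [[p ->] [q ->]] := conj (pi_surj u) (pi_surj v).
by rewrite -(piZ a p) -(sym_piM p q) -(sym_piM (a *: p) q) -(piZ a (p * q)) mulZl.
Qed.

HB.instance Definition _ := GRing.Lmodule_isLalgebra.Build k sym scaleAl.
HB.instance Definition _ := GRing.Lalgebra_isComAlgebra.Build k sym.

Definition sym_in (x : M) : sym := pi (sym_var x).

Lemma sym_in_is_linear : linear sym_in.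
Proof.
move=> a x y; rewrite -linearP; apply/qpiP/span_in.
by have := SymRel 1 a x y; rewrite mul1r.
Qed.
HB.instance Definition _ :=
  GRing.isLinear.Build k M sym *:%R sym_in sym_in_is_linear.

Section Lift.
Variables (A : comAlgType k) (f : {linear M -> A}).

Definition cmon_eval (m : {cmonom M}) : A := \prod_(x <- finsupp m) f x ^+ m x.

Lemma cmon_evalEw (d : {fset M}) (m : {cmonom M}) : {subset finsupp m <= d} ->
  cmon_eval m = \prod_(x <- d) f x ^+ m x.
Proof.
move=> /fsubsetP smd; rewrite /cmon_eval -(big_fset_incl _ smd) //= => x _.
by rewrite -cmE_eq0 => /eqP ->; rewrite expr0.
Qed.

Lemma cmon_eval1 : cmon_eval (@mone _) = 1.
Proof. by rewrite /cmon_eval mdom1 big_seq_fset0. Qed.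

Lemma cmon_evalM m n : cmon_eval (mmul m n) = cmon_eval m * cmon_eval n.
Proof.
have sm : {subset finsupp m <= finsupp (mmul m n)}.
  by move=> i; rewrite mdomD inE => ->.
have sn : {subset finsupp n <= finsupp (mmul m n)}.
  by move=> i; rewrite mdomD inE orbC => ->.
rewrite (cmon_evalEw sm) (cmon_evalEw sn) /cmon_eval -big_split /=.
by apply: eq_bigr => x _; rewrite cmM exprD.
Qed.

Lemma cmon_evalU x : cmon_eval (ucm x) = f x.
Proof. by rewrite /cmon_eval mdomU big_seq_fset1 cmUU expr1. Qed.

Definition sym_lift : sym -> A := qlift (flift cmon_eval).

Let evM (p q : freecom) :
  flift cmon_eval (p * q) = flift cmon_eval p * flift cmon_eval q.
Proof.
apply: (@free_ext _ _ _ (fun p => flift cmon_eval (p * q))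
                        (fun p => flift cmon_eval p * flift cmon_eval q)) p.
- by move=> a x y; rewrite mulrDl mulZl linearP.
- by move=> a x y; rewrite linearP mulrDl -scalerAl.
move=> m.
apply: (@free_ext _ _ _ (fun q => flift cmon_eval (fbase k m * q))
                        (fun q => flift cmon_eval (fbase k m) * flift cmon_eval q)) q.
- by move=> a x y; rewrite mulrDr mulZr linearP.
- by move=> a x y; rewrite linearP mulrDr -scalerAr.
move=> n.
have e : fbase k m * fbase k n = fbase k (mmul m n) := fbaseM k m n.
rewrite e; apply: etrans (fliftU cmon_eval (mmul m n)) _.
rewrite cmon_evalM; congr (_ * _); symmetry; [exact: (fliftU _ m)|exact: (fliftU _ n)].
Qed.

Let ev_rel (p : freecom) : sym_rel p -> flift cmon_eval p = 0.
Proof.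
case=> q a x y; rewrite evM; set r := (X in _ * X).
suff -> : r = 0 by rewrite mulr0.
have ev_var z : flift cmon_eval (sym_var z) = f z.
  exact: etrans (fliftU _ _) (cmon_evalU z).
suff comb (u v w : freecom) : flift cmon_eval u = f (a *: x + y) ->
    flift cmon_eval v = f x -> flift cmon_eval w = f y ->
    flift cmon_eval (u - (a *: v + w)) = 0 by apply: comb.
by move=> eu ev ew; rewrite linearB linearP /= eu ev ew linearP subrr.
Qed.

Lemma sym_lift_in x : sym_lift (sym_in x) = f x.
Proof. exact: etrans (qliftE ev_rel _) (etrans (fliftU _ _) (cmon_evalU x)). Qed.

Lemma sym_lift_is_linear : linear sym_lift.
Proof. exact: (qlift_is_linear ev_rel). Qed.

Lemma sym_lift1 : sym_lift 1 = 1.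
Proof.
have -> : 1 = pi (fbase k mone).
  by rewrite /fbase locked_withE -[LHS]/one /one locked_withE.
exact: etrans (qliftE ev_rel _) (etrans (fliftU _ _) cmon_eval1).
Qed.

Lemma sym_liftM u v : sym_lift (u * v) = sym_lift u * sym_lift v.
Proof.
have [[p ->] [q ->]] := conj (pi_surj u) (pi_surj v).
rewrite -sym_piM; apply: etrans (qliftE ev_rel _) _.
apply: etrans (evM _ _) _.
by congr (_ * _); symmetry; exact: (qliftE ev_rel).
Qed.

End Lift.

Lemma sym_ind (P : sym -> Prop) :
  P 1 -> (forall x u, P u -> P (sym_in x * u)) ->
  (forall a u v, P u -> P v -> P (a *: u + v)) -> forall u, P u.
Proof.
move=> P1 Pin Plin.
have P0 : P 0 by have := Plin (-1) 1 1 P1 P1; rewrite scaleN1r addNr.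
have Pmon m : P (pi (fbase k m)).
  elim/cmonom_ind: m => [|x m Pm].
    suff -> : pi (fbase k mone) = 1 by [].
    by rewrite /fbase locked_withE -[RHS]/one /one locked_withE.
  by rewrite -fbaseM sym_piM; apply: Pin.
move=> u; have [p ->] := pi_surj u; rewrite [p]monalgE.
elim: (X in \sum_(_ <- X) _) => [|m s IHs]; first by rewrite big_nil linear0.
rewrite big_cons; suff -> : << p@_m *g m >> = p@_m *: fbase k m.
  by rewrite linearP; apply: Plin.
exact: fbaseZ.
Qed.

End Sym.

Arguments sym_in {k M} x : rename.

Section Presented.
Variables (k : fieldType) (I : choiceType) (R : {malg k[I]} -> Prop).

(* the image of a generator in the k-module with generators I and relations R *)
Definition pgen (i : I) : qmod R := qpi R (fbase k i).

Lemma pres_ind (P : qmod R -> Prop) :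
  P 0 -> (forall i, P (pgen i)) ->
  (forall a u v, P u -> P v -> P (a *: u + v)) -> forall u, P u.
Proof.
move=> P0 Pgen Plin u; have [p ->] := qpi_surj u.
rewrite [p]monalgE.
elim: (X in \sum_(_ <- X) _) => [|m s IHs]; first by rewrite big_nil linear0.
by rewrite big_cons fbaseZ linearP; apply: Plin => //; apply: Pgen.
Qed.

Lemma pres_ext (N : lmodType k) (f g : qmod R -> N) :
  linear f -> linear g -> (forall i, f (pgen i) = g (pgen i)) -> f =1 g.
Proof.
move=> lf lg fg; apply: pres_ind => // [|a u v fu fv].
  by have := lf (-1) 0 0; have := lg (-1) 0 0; rewrite !scaler0 !addr0 !scaleN1r !addNr => -> ->.
by rewrite lf lg fu fv.
Qed.

Section Lift.
Variables (N : lmodType k) (h : I -> N).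

Definition pres_lift : qmod R -> N := qlift (flift h).

Hypothesis hR : forall r, R r -> flift h r = 0.

Lemma pres_liftE i : pres_lift (pgen i) = h i.
Proof. exact: etrans (qliftE hR _) (fliftU _ _). Qed.

Lemma pres_lift_is_linear : linear pres_lift.
Proof. exact: (qlift_is_linear hR). Qed.

End Lift.
End Presented.

Lemma flift_comb (k : fieldType) (I : choiceType) (N : lmodType k) (h : I -> N)
    (a : k) (i i1 i2 : I) :
  h i = a *: h i1 + h i2 ->
  flift h (fbase k i - (a *: fbase k i1 + fbase k i2)) = 0.
Proof. by move=> hi; rewrite linearB linearP /= !fliftU hi subrr. Qed.

Lemma linear_comb (k : fieldType) (M N : lmodType k) (f g : M -> N) (a : k) :
  linear f -> linear g -> linear (fun x => a *: f x + g x).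
Proof.
move=> lf lg b x y; rewrite lf lg !scalerDr !scalerA (mulrC a b).
by rewrite addrACA.
Qed.

Section TensorProduct.
Variables (k : fieldType) (W V : lmodType k).

Inductive tprod_rel : {malg k[(W * V)%type]} -> Prop :=
| TprodRelL a x y v : tprod_rel
    (fbase k (a *: x + y, v) - (a *: fbase k (x, v) + fbase k (y, v)))
| TprodRelR a w x y : tprod_rel
    (fbase k (w, a *: x + y) - (a *: fbase k (w, x) + fbase k (w, y))).

Definition tprod := qmod tprod_rel.
HB.instance Definition _ := GRing.Lmodule.on tprod.

Definition tprod_in (w : W) (v : V) : tprod := pgen tprod_rel (w, v).

Lemma tprod_in_linearl v : linear (tprod_in^~ v).
Proof. by move=> a x y; rewrite -linearP; apply/qpiP/span_in/TprodRelL. Qed.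

Lemma tprod_in_linearr w : linear (tprod_in w).
Proof. by move=> a x y; rewrite -linearP; apply/qpiP/span_in/TprodRelR. Qed.

Section Lift.
Variables (N : lmodType k) (f : W -> V -> N).
Hypothesis fl : forall v, linear (f^~ v).
Hypothesis fr : forall w, linear (f w).

Definition tprod_lift : tprod -> N := pres_lift (fun wv => f wv.1 wv.2).

Let fR r : tprod_rel r -> flift (fun wv => f wv.1 wv.2) r = 0.
Proof. by case=> *; apply: flift_comb; [apply: fl|apply: fr]. Qed.

Lemma tprod_liftE w v : tprod_lift (tprod_in w v) = f w v.
Proof. exact: (pres_liftE fR (w, v)). Qed.

Lemma tprod_lift_is_linear : linear tprod_lift.
Proof. exact: (pres_lift_is_linear fR). Qed.

End Lift.

Lemma tprod_ext (N : lmodType k) (f g : tprod -> N) :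
  linear f -> linear g ->
  (forall w v, f (tprod_in w v) = g (tprod_in w v)) -> f =1 g.
Proof. by move=> lf lg fg; apply: pres_ext => // -[w v]; apply: fg. Qed.

End TensorProduct.

Section TensorPower.
Variables (k : fieldType) (M : lmodType k) (n : nat).

Definition tset (t : n.-tuple M) (i : 'I_n) (x : M) : n.-tuple M :=
  [tuple if j == i then x else tnth t j | j < n].

Definition multilinear (N : lmodType k) (f : n.-tuple M -> N) :=
  forall t i, linear (fun x => f (tset t i x)).

Inductive tpow_rel : {malg k[n.-tuple M]} -> Prop :=
  TpowRel t i a x y : tpow_rel
    (fbase k (tset t i (a *: x + y))
      - (a *: fbase k (tset t i x) + fbase k (tset t i y))).

Definition tpow := qmod tpow_rel.
HB.instance Definition _ := GRing.Lmodule.on tpow.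

Definition tens (t : n.-tuple M) : tpow := pgen tpow_rel t.

Lemma tens_multilinear : multilinear tens.
Proof. by move=> t i a x y; rewrite -linearP; apply/qpiP/span_in/TpowRel. Qed.

Section Lift.
Variables (N : lmodType k) (f : n.-tuple M -> N).

Definition tpow_lift : tpow -> N := pres_lift f.

Hypothesis fm : multilinear f.

Let fR r : tpow_rel r -> flift f r = 0.
Proof. by case=> *; apply: flift_comb; apply: fm. Qed.

Lemma tpow_liftE t : tpow_lift (tens t) = f t.
Proof. exact: (pres_liftE fR). Qed.

Lemma tpow_lift_is_linear : linear tpow_lift.
Proof. exact: (pres_lift_is_linear fR). Qed.

End Lift.

Lemma tpow_ext (N : lmodType k) (f g : tpow -> N) :
  linear f -> linear g -> (forall t, f (tens t) = g (tens t)) -> f =1 g.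
Proof. exact: pres_ext. Qed.

End TensorPower.

Section TupleOps.
Variables (k : fieldType) (M : lmodType k).

Lemma map_tset (N : lmodType k) n (f : M -> N) (t : n.-tuple M) i x :
  map_tuple f (tset t i x) = tset (map_tuple f t) i (f x).
Proof.
by apply: eq_from_tnth => j; rewrite tnth_map !tnth_mktuple tnth_map; case: ifP.
Qed.

Definition tperm_tuple n (s : 'S_n) (t : n.-tuple M) : n.-tuple M :=
  [tuple tnth t (s i) | i < n].

Lemma tperm_tset n (s : 'S_n) (t : n.-tuple M) i x :
  tperm_tuple s (tset t i x) = tset (tperm_tuple s t) (s^-1%g i) x.
Proof.
apply: eq_from_tnth => j; rewrite !tnth_mktuple.
by rewrite (can2_eq (permK s) (permKV s)).
Qed.

Lemma cat_tsetl m n (t : m.-tuple M) (u : n.-tuple M) i x :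
  cat_tuple (tset t i x) u = tset (cat_tuple t u) (lshift n i) x.
Proof.
apply: eq_from_tnth => j; rewrite !tnth_mktuple.
case: (split_ordP j) => j' ->; rewrite ?tnth_lshift ?tnth_rshift.
  by rewrite tnth_mktuple (inj_eq (@lshift_inj _ _)).
by rewrite eq_rlshift.
Qed.

Lemma cat_tsetr m n (t : m.-tuple M) (u : n.-tuple M) i x :
  cat_tuple t (tset u i x) = tset (cat_tuple t u) (rshift m i) x.
Proof.
apply: eq_from_tnth => j; rewrite !tnth_mktuple.
case: (split_ordP j) => j' ->; rewrite ?tnth_lshift ?tnth_rshift.
  by rewrite eq_lrshift.
by rewrite tnth_mktuple (inj_eq (@rshift_inj _ _)).
Qed.

Definition tuple_l m n (t : (m + n).-tuple M) : m.-tuple M :=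
  [tuple tnth t (lshift n i) | i < m].
Definition tuple_r m n (t : (m + n).-tuple M) : n.-tuple M :=
  [tuple tnth t (rshift m i) | i < n].

End TupleOps.

Section SymmetricGroups.

Definition perm_block_fun m n (s : 'S_m) (t : 'S_n) (i : 'I_(m + n)) : 'I_(m + n) :=
  match fintype.split i with inl a => lshift n (s a) | inr b => rshift m (t b) end.

Fact perm_block_inj m n (s : 'S_m) (t : 'S_n) : injective (perm_block_fun s t).
Proof.
move=> i j; rewrite /perm_block_fun.
case: (split_ordP i) => a ->; case: (split_ordP j) => b -> /eqP.
- by rewrite (inj_eq (@lshift_inj _ _)) (inj_eq perm_inj) => /eqP ->.
- by rewrite eq_lrshift.
- by rewrite eq_rlshift.
- by rewrite (inj_eq (@rshift_inj _ _)) (inj_eq perm_inj) => /eqP ->.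
Qed.

(* the image of (s, t) under the embedding of 'S_m x 'S_n in 'S_(m + n) *)
Definition perm_block m n (s : 'S_m) (t : 'S_n) : 'S_(m + n) :=
  perm (@perm_block_inj m n s t).

Definition tau_fun m n (i : 'I_(m + n)) : 'I_(m + n) :=
  match fintype.split i with
  | inl a => cast_ord (addnC n m) (rshift n a)
  | inr b => cast_ord (addnC n m) (lshift m b)
  end.

Fact tau_inj m n : injective (@tau_fun m n).
Proof.
move=> i j; rewrite /tau_fun.
case: (split_ordP i) => a ->; case: (split_ordP j) => b -> /cast_ord_inj/eqP.
- by rewrite (inj_eq (@rshift_inj _ _)) => /eqP ->.
- by rewrite eq_rlshift.
- by rewrite eq_lrshift.
- by rewrite (inj_eq (@lshift_inj _ _)) => /eqP ->.
Qed.

(* i |-> i + n for i < m, and i |-> i - m for m <= i < m + n *)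
Definition tau m n : 'S_(m + n) := perm (@tau_inj m n).

End SymmetricGroups.

Definition castn (k : fieldType) (A : nat -> lmodType k) m n (e : m = n) (x : A m) :
  A n := eq_rect m A x n e.

(* An 'S_*-representation with an associative, unital and twisted commutative
   product. In mathcomp (s * t) i = t (s i), so that left actions of the
   symmetric groups satisfy tca_actM as stated here. *)
Record tca (k : fieldType) := Tca {
  tca_mod :> nat -> lmodType k;
  tca_act : forall n, 'S_n -> tca_mod n -> tca_mod n;
  tca_one : tca_mod 0;
  tca_mul : forall m n, tca_mod m -> tca_mod n -> tca_mod (m + n);
  tca_act_linear : forall n (s : 'S_n), linear (tca_act s);
  tca_act1 : forall n (x : tca_mod n), tca_act 1%g x = x;
  tca_actM : forall n (s t : 'S_n) (x : tca_mod n),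
    tca_act (s * t)%g x = tca_act t (tca_act s x);
  tca_mul_linearl : forall m n (y : tca_mod n),
    linear (fun x : tca_mod m => tca_mul x y);
  tca_mul_linearr : forall m n (x : tca_mod m),
    linear (fun y : tca_mod n => tca_mul x y);
  tca_mulA : forall m n p (x : tca_mod m) (y : tca_mod n) (z : tca_mod p),
    castn (addnA m n p) (tca_mul x (tca_mul y z)) = tca_mul (tca_mul x y) z;
  tca_mul1 : forall n (x : tca_mod n), tca_mul tca_one x = x;
  tca_mulr1 : forall n (x : tca_mod n), castn (addn0 n) (tca_mul x tca_one) = x;
  tca_mul_act : forall m n (s : 'S_m) (t : 'S_n) (x : tca_mod m) (y : tca_mod n),
    tca_mul (tca_act s x) (tca_act t y) = tca_act (perm_block s t) (tca_mul x y);
  tca_mulC : forall n m (x : tca_mod n) (y : tca_mod m),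
    tca_mul x y = castn (addnC m n) (tca_act (tau m n) (tca_mul y x))
}.

Arguments tca_act {k} A {n} s x : rename.
Arguments tca_one {k} A : rename.
Arguments tca_mul {k} A {m n} x y : rename.

Record tca_iso (k : fieldType) (A B : tca k) (phi : forall n, A n -> B n) : Prop :=
  TcaIso {
    tca_iso_linear : forall n, linear (@phi n);
    tca_iso_bij : forall n, bijective (@phi n);
    tca_iso_act : forall n (s : 'S_n) (x : A n),
      phi n (tca_act A s x) = tca_act B s (phi n x);
    tca_iso_one : phi 0 (tca_one A) = tca_one B;
    tca_iso_mul : forall m n (x : A m) (y : A n),
      phi (m + n) (tca_mul A x y) = tca_mul B (phi m x) (phi n y)
  }.

(* the smallest family of subspaces of A that contains X and the unit and is
   stable under products and under the symmetric groups *)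
Inductive tca_gen (k : fieldType) (A : tca k) (X : forall n, A n -> Prop) :
    forall n, A n -> Prop :=
| tca_gen_in n x : X n x -> tca_gen X x
| tca_gen_one : tca_gen X (tca_one A)
| tca_gen_0 n : tca_gen X (0 : A n)
| tca_gen_lin n a (x y : A n) :
    tca_gen X x -> tca_gen X y -> tca_gen X (a *: x + y)
| tca_gen_mul m n (x : A m) (y : A n) :
    tca_gen X x -> tca_gen X y -> tca_gen X (tca_mul A x y)
| tca_gen_act n (s : 'S_n) (x : A n) : tca_gen X x -> tca_gen X (tca_act A s x).

Section TensorTca.
Variables (k : fieldType) (W : lmodType k).

Local Notation tpowW := (fun n => tpow W n : lmodType k).

Lemma castn_linear (A : nat -> lmodType k) m n (e : m = n) :
  linear (fun x : A m => castn e x).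
Proof. by case: n / e. Qed.

Lemma castn_tens m n (e : m = n) (t : m.-tuple W) :
  castn (A := tpowW) e (tens t) = tens (tcast e t).
Proof. by case: n / e. Qed.

(* s acts by w_1 ... w_n |-> w_(s^-1 1) ... w_(s^-1 n) *)
Definition tpow_act n (s : 'S_n) : tpow W n -> tpow W n :=
  tpow_lift (fun t => tens (tperm_tuple s^-1%g t)).

Let act_ml n (s : 'S_n) : multilinear (fun t => tens (tperm_tuple s^-1%g t : n.-tuple W)).
Proof. by move=> t i a x y; rewrite !tperm_tset; apply: tens_multilinear. Qed.

Lemma tpow_actE n (s : 'S_n) t : tpow_act s (tens t) = tens (tperm_tuple s^-1%g t).
Proof. exact: (tpow_liftE (act_ml s)). Qed.

Lemma tpow_act_linear n (s : 'S_n) : linear (tpow_act s).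
Proof. exact: (tpow_lift_is_linear (act_ml s)). Qed.

Lemma tpow_act1 n (x : tpow W n) : tpow_act 1%g x = x.
Proof.
apply: (@tpow_ext _ _ _ _ _ id) => //; first exact: tpow_act_linear.
move=> t; rewrite tpow_actE; congr tens; apply: eq_from_tnth => i.
by rewrite tnth_mktuple invg1 perm1.
Qed.

Lemma tpow_actM n (s t : 'S_n) (x : tpow W n) :
  tpow_act (s * t)%g x = tpow_act t (tpow_act s x).
Proof.
apply: (@tpow_ext _ _ _ _ _ (tpow_act t \o tpow_act s)) => /=.
- exact: tpow_act_linear.
- by move=> a u v /=; rewrite !tpow_act_linear.
move=> u /=; rewrite !tpow_actE; congr tens; apply: eq_from_tnth => i.
by rewrite !tnth_mktuple invMg permM.
Qed.

Definition tpow_mul m n (x : tpow W m) (y : tpow W n) : tpow W (m + n) :=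
  tpow_lift (fun t => tpow_lift (fun u => tens (cat_tuple t u)) y) x.

Let cat_mlr m n (t : m.-tuple W) : multilinear (fun u : n.-tuple W => tens (cat_tuple t u)).
Proof. by move=> u i a x y; rewrite !cat_tsetr; apply: tens_multilinear. Qed.

Let cat_mll m n (y : tpow W n) :
  multilinear (fun t : m.-tuple W => tpow_lift (fun u => tens (cat_tuple t u)) y).
Proof.
move=> t i a x x'.
have lin (v : m.-tuple W) := tpow_lift_is_linear (@cat_mlr m n v).
apply: (tpow_ext (lin _) (linear_comb a (lin _) (lin _))) => u.
have E (v : m.-tuple W) := tpow_liftE (cat_mlr v) u.
by rewrite E E E !cat_tsetl; apply: tens_multilinear.
Qed.

Lemma tpow_mulE m n (t : m.-tuple W) (u : n.-tuple W) :
  tpow_mul (tens t) (tens u) = tens (cat_tuple t u).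
Proof. exact: etrans (tpow_liftE (cat_mll _) _) (tpow_liftE (cat_mlr _) _). Qed.

Lemma tpow_mul_linearl m n (y : tpow W n) :
  linear (fun x : tpow W m => tpow_mul x y).
Proof. exact: (tpow_lift_is_linear (cat_mll _)). Qed.

Lemma tpow_mul_linearr m n (x : tpow W m) :
  linear (fun y : tpow W n => tpow_mul x y).
Proof.
move=> a y y'.
have lin (z : tpow W n) := @tpow_mul_linearl m n z.
apply: (tpow_ext (lin _) (linear_comb a (lin _) (lin _))) => t.
have E (z : tpow W n) : tpow_mul (tens t) z =
  tpow_lift (fun u => tens (cat_tuple t u)) z := tpow_liftE (cat_mll z) t.
by rewrite E E E (tpow_lift_is_linear (cat_mlr t)).
Qed.

Lemma tpow_mulA m n p (x : tpow W m) (y : tpow W n) (z : tpow W p) :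
  castn (A := tpowW) (addnA m n p) (tpow_mul x (tpow_mul y z)) =
  tpow_mul (tpow_mul x y) z.
Proof.
pose c := fun x : tpow W (m + (n + p)) => castn (A := tpowW) (addnA m n p) x.
have lc : linear c by apply: (@castn_linear tpowW).
rewrite -[LHS]/(c _).
apply: (@tpow_ext _ _ _ _ (fun x => c (tpow_mul x (tpow_mul y z)))
   (fun x => tpow_mul (tpow_mul x y) z)) => [a u v|a u v|t].
- by rewrite tpow_mul_linearl lc.
- by rewrite !tpow_mul_linearl.
apply: (@tpow_ext _ _ _ _ (fun y => c (tpow_mul (tens t) (tpow_mul y z)))
   (fun y => tpow_mul (tpow_mul (tens t) y) z)) => [a u v|a u v|u].
- by rewrite tpow_mul_linearl tpow_mul_linearr lc.
- by rewrite tpow_mul_linearr tpow_mul_linearl.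
apply: (@tpow_ext _ _ _ _ (fun z => c (tpow_mul (tens t) (tpow_mul (tens u) z)))
   (fun z => tpow_mul (tpow_mul (tens t) (tens u)) z)) => [a v w|a v w|v].
- by rewrite !tpow_mul_linearr lc.
- by rewrite !tpow_mul_linearr.
rewrite !tpow_mulE /c castn_tens; congr tens; apply: val_inj.
by apply: etrans (val_tcast _ _) _; rewrite /= catA.
Qed.

Lemma tpow_mul1 n (x : tpow W n) : tpow_mul (tens [tuple]) x = x.
Proof.
apply: (@tpow_ext _ _ _ _ (fun x => tpow_mul (tens [tuple]) x) id) => //.
  exact: tpow_mul_linearr.
by move=> t; rewrite tpow_mulE; congr tens; apply: val_inj.
Qed.

Lemma tpow_mulr1 n (x : tpow W n) :
  castn (A := tpowW) (addn0 n) (tpow_mul x (tens [tuple])) = x.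
Proof.
apply: (@tpow_ext _ _ _ _ (fun x : tpow W n => 
  castn (A := tpowW) (addn0 n) (tpow_mul x (tens [tuple]))) id) => //.
  by move=> a u v; rewrite tpow_mul_linearl (@castn_linear tpowW).
move=> t; rewrite tpow_mulE castn_tens; congr tens; apply: val_inj.
by apply: etrans (val_tcast _ _) _; rewrite /= cats0.
Qed.

Lemma perm_blockV m n (s : 'S_m) (t : 'S_n) :
  (perm_block s t)^-1%g = perm_block s^-1 t^-1.
Proof.
apply/permP => i; apply: (@perm_inj _ (perm_block s t)); rewrite permKV.
rewrite ![perm_block _ _ _]permE /perm_block_fun.
by case: (split_ordP i) => j ->; rewrite ?(unsplitK (inl _)) ?(unsplitK (inr _)) permKV.
Qed.

Lemma perm_blockl m n (s : 'S_m) (t : 'S_n) i :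
  perm_block s t (lshift n i) = lshift n (s i).
Proof. by rewrite permE /perm_block_fun (unsplitK (inl _)). Qed.

Lemma perm_blockr m n (s : 'S_m) (t : 'S_n) i :
  perm_block s t (rshift m i) = rshift m (t i).
Proof. by rewrite permE /perm_block_fun (unsplitK (inr _)). Qed.

Lemma tpow_mul_act m n (s : 'S_m) (t : 'S_n) (x : tpow W m) (y : tpow W n) :
  tpow_mul (tpow_act s x) (tpow_act t y) = tpow_act (perm_block s t) (tpow_mul x y).
Proof.
apply: (@tpow_ext _ _ _ _ (fun x => tpow_mul (tpow_act s x) (tpow_act t y))
   (fun x => tpow_act (perm_block s t) (tpow_mul x y))) => [a u v|a u v|v].
- by rewrite tpow_act_linear tpow_mul_linearl.
- by rewrite tpow_mul_linearl tpow_act_linear.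
apply: (@tpow_ext _ _ _ _ (fun y => tpow_mul (tpow_act s (tens v)) (tpow_act t y))
   (fun y => tpow_act (perm_block s t) (tpow_mul (tens v) y))) => [a u w|a u w|u].
- by rewrite tpow_act_linear tpow_mul_linearr.
- by rewrite tpow_mul_linearr tpow_act_linear.
rewrite !(tpow_actE, tpow_mulE); congr tens; apply: eq_from_tnth => i.
rewrite tnth_mktuple perm_blockV.
case: (split_ordP i) => j ->.
  by rewrite perm_blockl !tnth_lshift tnth_mktuple.
by rewrite perm_blockr !tnth_rshift tnth_mktuple.
Qed.

Lemma tauVl m n (i : 'I_n) (j : 'I_(n + m)) : j = lshift m i ->
  (tau m n)^-1%g (cast_ord (addnC n m) j) = rshift m i.
Proof.
move=> ->; apply: (@perm_inj _ (tau m n)); rewrite permKV permE /tau_fun.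
by rewrite (unsplitK (inr _)).
Qed.

Lemma tauVr m n (i : 'I_m) (j : 'I_(n + m)) : j = rshift n i ->
  (tau m n)^-1%g (cast_ord (addnC n m) j) = lshift n i.
Proof.
move=> ->; apply: (@perm_inj _ (tau m n)); rewrite permKV permE /tau_fun.
by rewrite (unsplitK (inl _)).
Qed.

Lemma tpow_mulC n m (x : tpow W n) (y : tpow W m) :
  tpow_mul x y =
  castn (A := tpowW) (addnC m n) (tpow_act (tau m n) (tpow_mul y x)).
Proof.
pose c := fun x : tpow W (m + n) => castn (A := tpowW) (addnC m n) x.
have lc : linear c by apply: (@castn_linear tpowW).
rewrite -[RHS]/(c _).
apply: (@tpow_ext _ _ _ _ (fun x => tpow_mul x y)
   (fun x => c (tpow_act (tau m n) (tpow_mul y x)))) => [a u v|a u v|t].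
- by rewrite tpow_mul_linearl.
- by rewrite tpow_mul_linearr tpow_act_linear lc.
apply: (@tpow_ext _ _ _ _ (fun y => tpow_mul (tens t) y)
   (fun y => c (tpow_act (tau m n) (tpow_mul y (tens t))))) => [a u v|a u v|u].
- by rewrite tpow_mul_linearr.
- by rewrite tpow_mul_linearl tpow_act_linear lc.
rewrite !tpow_mulE tpow_actE /c castn_tens; congr tens; apply: eq_from_tnth => i.
rewrite tcastE tnth_mktuple.
rewrite (_ : esym _ = addnC n m); last exact: eq_irrelevance.
case: (split_ordP i) => j ij.
  by rewrite (tauVl ij) ij tnth_lshift tnth_rshift.
by rewrite (tauVr ij) ij tnth_lshift tnth_rshift.
Qed.

Definition tensor_tca : tca k := {|
  tca_mod n := tpow W n : lmodType k;
  tca_act n s := @tpow_act n s;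
  tca_one := tens [tuple];
  tca_mul m n := @tpow_mul m n;
  tca_act_linear := tpow_act_linear;
  tca_act1 := tpow_act1;
  tca_actM := tpow_actM;
  tca_mul_linearl := tpow_mul_linearl;
  tca_mul_linearr := tpow_mul_linearr;
  tca_mulA := tpow_mulA;
  tca_mul1 := tpow_mul1;
  tca_mulr1 := tpow_mulr1;
  tca_mul_act := tpow_mul_act;
  tca_mulC := tpow_mulC |}.

End TensorTca.

Record linrep (k : fieldType) (G : groupType) (M : lmodType k) := LinRep {
  rep_fun :> G -> M -> M;
  rep_linear : forall g, linear (rep_fun g);
  rep1 : forall x, rep_fun 1%g x = x;
  repM : forall g h x, rep_fun (g * h)%g x = rep_fun g (rep_fun h x)
}.

HB.instance Definition _ (k : fieldType) (G : groupType) (M : lmodType k)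
    (rho : linrep G M) (g : G) :=
  GRing.isLinear.Build k M M *:%R (rep_fun rho g) (rep_linear rho g).

Definition invariants (k : fieldType) (G : groupType) (M : lmodType k)
  (rho : linrep G M) : M -> Prop := fun x => forall g, rho g x = x.

Definition is_subrep (k : fieldType) (G : groupType) (M : lmodType k)
    (rho : linrep G M) (U : M -> Prop) : Prop :=
  [/\ U 0, forall a x y, U x -> U y -> U (a *: x + y)
    & forall g x, U x -> U (rho g x)].

Definition is_algrep (k : fieldType) (G : groupType) (A : comAlgType k)
    (rho : linrep G A) : Prop :=
  forall g, rho g 1 = 1 /\ {morph rho g : x y / x * y}.

Inductive alg_gen (k : fieldType) (A : comAlgType k) (X : A -> Prop) : A -> Prop :=
| alg_gen_in x : X x -> alg_gen X x
| alg_gen_1 : alg_gen X 1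
| alg_gen_lin a x y : alg_gen X x -> alg_gen X y -> alg_gen X (a *: x + y)
| alg_gen_mul x y : alg_gen X x -> alg_gen X y -> alg_gen X (x * y).

Section RepConstructions.
Variables (k : fieldType) (G : groupType).

Section TensorPowers.
Variables (M : lmodType k) (rho : linrep G M) (n : nat).

Definition tpow_rep_fun (g : G) : tpow M n -> tpow M n :=
  tpow_lift (fun t => tens (map_tuple (rho g) t)).

Let ml g : multilinear (fun t : n.-tuple M => tens (map_tuple (rho g) t)).
Proof. by move=> t i a x y; rewrite !map_tset linearP; apply: tens_multilinear. Qed.

Lemma tpow_rep_funE g t : tpow_rep_fun g (tens t) = tens (map_tuple (rho g) t).
Proof. exact: (tpow_liftE (ml g)). Qed.

Lemma tpow_rep_linear g : linear (tpow_rep_fun g).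
Proof. exact: (tpow_lift_is_linear (ml g)). Qed.

Lemma tpow_rep1 x : tpow_rep_fun 1%g x = x.
Proof.
apply: (@tpow_ext _ _ _ _ _ id) => //; first exact: tpow_rep_linear.
move=> t; rewrite tpow_rep_funE; congr tens; apply: eq_from_tnth => i.
by rewrite tnth_map rep1.
Qed.

Lemma tpow_repM g h x :
  tpow_rep_fun (g * h)%g x = tpow_rep_fun g (tpow_rep_fun h x).
Proof.
apply: (@tpow_ext _ _ _ _ _ (fun x => tpow_rep_fun g (tpow_rep_fun h x))).
- exact: tpow_rep_linear.
- by move=> a u v; rewrite !tpow_rep_linear.
move=> t; rewrite !tpow_rep_funE; congr tens; apply: eq_from_tnth => i.
by rewrite !tnth_map repM.
Qed.

Definition tpow_rep : linrep G (tpow M n) :=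
  LinRep tpow_rep_linear tpow_rep1 tpow_repM.

Lemma tpow_repE g t : tpow_rep g (tens t) = tens (map_tuple (rho g) t).
Proof. exact: tpow_rep_funE. Qed.

End TensorPowers.

Section TensorProducts.
Variables (W V : lmodType k).

Definition tprodl_fun (rho : linrep G W) (g : G) : tprod W V -> tprod W V :=
  tprod_lift (fun w v => tprod_in (rho g w) v).
Definition tprodr_fun (rho : linrep G V) (g : G) : tprod W V -> tprod W V :=
  tprod_lift (fun w v => tprod_in w (rho g v)).

Section Left.
Variable rho : linrep G W.
Let ll g v : linear (fun w => tprod_in (rho g w) v : tprod W V).
Proof. by move=> a x y; rewrite linearP tprod_in_linearl. Qed.
Let lr g w : linear (fun v => tprod_in (rho g w) v : tprod W V).
Proof. exact: tprod_in_linearr. Qed.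

Lemma tprodl_funE g w v : tprodl_fun rho g (tprod_in w v) = tprod_in (rho g w) v.
Proof. exact: (tprod_liftE (ll g) (lr g)). Qed.

Lemma tprodl_linear g : linear (tprodl_fun rho g).
Proof. exact: (tprod_lift_is_linear (ll g) (lr g)). Qed.

Lemma tprodl1 x : tprodl_fun rho 1%g x = x.
Proof.
apply: (@tprod_ext _ _ _ _ _ id) => //; first exact: tprodl_linear.
by move=> w v; rewrite tprodl_funE rep1.
Qed.

Lemma tprodlM g h x :
  tprodl_fun rho (g * h)%g x = tprodl_fun rho g (tprodl_fun rho h x).
Proof.
apply: (@tprod_ext _ _ _ _ _ (fun x => tprodl_fun rho g (tprodl_fun rho h x))).
- exact: tprodl_linear.
- by move=> a u v; rewrite !tprodl_linear.
by move=> w v; rewrite !tprodl_funE repM.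
Qed.

Definition tprodl_rep : linrep G (tprod W V) :=
  LinRep tprodl_linear tprodl1 tprodlM.
End Left.

Section Right.
Variable rho : linrep G V.
Let ll g v : linear (fun w => tprod_in w (rho g v) : tprod W V).
Proof. exact: tprod_in_linearl. Qed.
Let lr g w : linear (fun v => tprod_in w (rho g v) : tprod W V).
Proof. by move=> a x y; rewrite linearP tprod_in_linearr. Qed.

Lemma tprodr_funE g w v : tprodr_fun rho g (tprod_in w v) = tprod_in w (rho g v).
Proof. exact: (tprod_liftE (ll g) (lr g)). Qed.

Lemma tprodr_linear g : linear (tprodr_fun rho g).
Proof. exact: (tprod_lift_is_linear (ll g) (lr g)). Qed.

Lemma tprodr1 x : tprodr_fun rho 1%g x = x.
Proof.
apply: (@tprod_ext _ _ _ _ _ id) => //; first exact: tprodr_linear.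
by move=> w v; rewrite tprodr_funE rep1.
Qed.

Lemma tprodrM g h x :
  tprodr_fun rho (g * h)%g x = tprodr_fun rho g (tprodr_fun rho h x).
Proof.
apply: (@tprod_ext _ _ _ _ _ (fun x => tprodr_fun rho g (tprodr_fun rho h x))).
- exact: tprodr_linear.
- by move=> a u v; rewrite !tprodr_linear.
by move=> w v; rewrite !tprodr_funE repM.
Qed.

Definition tprodr_rep : linrep G (tprod W V) :=
  LinRep tprodr_linear tprodr1 tprodrM.
End Right.
End TensorProducts.

Section SymmetricAlgebras.
Variables (M : lmodType k) (rho : linrep G M).

Definition sym_rep_fun (g : G) : sym M -> sym M := sym_lift (sym_in \o rho g).

Lemma sym_rep_in g x : sym_rep_fun g (sym_in x) = sym_in (rho g x).
Proof. exact: sym_lift_in. Qed.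

Lemma sym_rep_linear g : linear (sym_rep_fun g).
Proof. exact: sym_lift_is_linear. Qed.

Lemma sym_rep_one g : sym_rep_fun g 1 = 1.
Proof. exact: sym_lift1. Qed.

Lemma sym_rep_mul g : {morph sym_rep_fun g : x y / x * y}.
Proof. exact: sym_liftM. Qed.

Lemma sym_rep1 x : sym_rep_fun 1%g x = x.
Proof.
elim/sym_ind: x => [|x u IHu|a u v IHu IHv]; first exact: sym_rep_one.
  by rewrite sym_rep_mul sym_rep_in rep1 IHu.
by rewrite sym_rep_linear IHu IHv.
Qed.

Lemma sym_repM g h x : sym_rep_fun (g * h)%g x = sym_rep_fun g (sym_rep_fun h x).
Proof.
elim/sym_ind: x => [|x u IHu|a u v IHu IHv]; first by rewrite !sym_rep_one.
  by rewrite !sym_rep_mul !sym_rep_in repM IHu.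
by rewrite !sym_rep_linear IHu IHv.
Qed.

Definition sym_rep : linrep G (sym M) := LinRep sym_rep_linear sym_rep1 sym_repM.

Lemma sym_rep_alg : is_algrep sym_rep.
Proof. by move=> g; split; [exact: sym_rep_one|exact: sym_rep_mul]. Qed.

End SymmetricAlgebras.
End RepConstructions.

Section GL.
Variables (k : fieldType) (M : lmodType k).

Definition gl_pred (f : M -> M) : bool := `[< linear f /\ bijective f >].

Record GL := MkGL { gl_fun :> M -> M; glP : gl_pred gl_fun }.
HB.instance Definition _ := [isSub for gl_fun].
HB.instance Definition _ := [Choice of GL by <:].

Lemma gl_linear (g : GL) : linear g.
Proof. by have /asboolP[] := glP g. Qed.

Lemma gl_bij (g : GL) : bijective g.
Proof. by have /asboolP[] := glP g. Qed.

Fact gl_idP : gl_pred id.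
Proof. by apply/asboolP; split=> //; exists id. Qed.

Fact gl_compP (g h : GL) : gl_pred (g \o h).
Proof.
apply/asboolP; split; last by apply: bij_comp; apply: gl_bij.
by move=> a x y /=; rewrite !gl_linear.
Qed.

Fact gl_invP (g : GL) : exists f : GL, cancel g f /\ cancel f g.
Proof.
have [f gf fg] := gl_bij g; suff fP : gl_pred f by exists (MkGL fP).
apply/asboolP; split; last by exists g.
by move=> a x y; apply: (can_inj gf); rewrite fg gl_linear !fg.
Qed.

Definition gl_one := MkGL gl_idP.
Definition gl_mul g h := MkGL (gl_compP g h).
Definition gl_inv g := sval (cid (gl_invP g)).

Fact gl_mulA : associative gl_mul.
Proof. by move=> f g h; apply: val_inj. Qed.
Fact gl_mul1 : left_id gl_one gl_mul.
Proof. by move=> g; apply: val_inj. Qed.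
Fact gl_mulr1 : right_id gl_one gl_mul.
Proof. by move=> g; apply: val_inj. Qed.
Fact gl_mulV : left_inverse gl_one gl_inv gl_mul.
Proof.
by move=> g; apply: val_inj; apply/funext; rewrite /gl_inv; case: cid => f [].
Qed.
Fact gl_mulrV : right_inverse gl_one gl_inv gl_mul.
Proof.
by move=> g; apply: val_inj; apply/funext; rewrite /gl_inv; case: cid => f [].
Qed.

HB.instance Definition _ :=
  isGroup.Build GL gl_mulA gl_mul1 gl_mulr1 gl_mulV gl_mulrV.

Definition std_rep : linrep GL M :=
  @LinRep k GL M gl_fun gl_linear (fun=> erefl) (fun _ _ _ => erefl).

End GL.

(* the k-vector space with basis indexed by nat; ebase k 0 is e_1, and so on *)
Definition Vinf (k : fieldType) : lmodType k := {malg k[nat]}.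
Definition ebase (k : fieldType) (i : nat) : Vinf k := fbase k i.

Section Schur.
Variables (k : fieldType) (M : lmodType k) (rho : linrep (GL (Vinf k)) M).

Definition gl_hom n (f : tpow (Vinf k) n -> M) : Prop :=
  linear f /\ forall g x, f (tpow_rep (std_rep (Vinf k)) n g x) = rho g (f x).

Section Degree.
Variable n : nat.

Definition schur_pred : {pred (tpow (Vinf k) n -> M)} := fun f => `[< gl_hom f >].

Fact schur_submod_closed : submod_closed schur_pred.
Proof.
split=> [|a f h /asboolP[lf ef] /asboolP[lh eh]]; apply/asboolP; split.
- by move=> a x y; rewrite /= scaler0 addr0.
- by move=> g x; rewrite /= linear0.
- have l := linear_comb a lf lh; exact: l.
- move=> g x; have E y : (a *: f + h) y = a *: f y + h y by [].
  by rewrite !E ef eh linearP.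
Qed.
HB.instance Definition _ :=
  GRing.isSubmodClosed.Build k _ schur_pred schur_submod_closed.

(* Hom_GL(V^(x)n, M) *)
Record schur := Schur {
  schur_fun :> tpow (Vinf k) n -> M;
  schurP : schur_fun \in schur_pred
}.
HB.instance Definition _ := [isSub for schur_fun].
HB.instance Definition _ := [Choice of schur by <:].
HB.instance Definition _ := [SubChoice_isSubLmodule of schur by <:].

Lemma schur_linear (f : schur) : linear f.
Proof. by have /asboolP[] := schurP f. Qed.

Lemma schur_equiv (f : schur) g x :
  f (tpow_rep (std_rep (Vinf k)) n g x) = rho g (f x).
Proof. by have /asboolP[_] := schurP f; apply. Qed.

Lemma schur_ext (f h : schur) : (forall t, f (tens t) = h (tens t)) -> f = h.
Proof.
move=> fh; apply/val_inj/funext => x.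
by apply: (tpow_ext (schur_linear f) (schur_linear h)).
Qed.

(* for a subrepresentation U of M, the homomorphisms with image in U are
   the elements of Hom_GL(V^(x)n, U) *)
Definition schur_sub (U : M -> Prop) (f : schur) : Prop := forall x, U (f x).

End Degree.
End Schur.

Section SchurTca.
Variables (k : fieldType) (A : comAlgType k) (rho : linrep (GL (Vinf k)) A).
Hypothesis rhoA : is_algrep rho.

Local Notation V := (Vinf k).
Local Notation gl_std := (std_rep V).
Local Notation S := (schur rho).

Fact schur_one_hom : gl_hom rho (tpow_lift (fun _ : 0.-tuple V => 1)).
Proof.
have ml : multilinear (fun _ : 0.-tuple V => 1 : A) by move=> t [].
split; first exact: (tpow_lift_is_linear ml).
move=> g; apply: tpow_ext => [||t].
- by move=> a x y; rewrite rep_linear (tpow_lift_is_linear ml).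
- by move=> a x y; rewrite (tpow_lift_is_linear ml) rep_linear.
by rewrite tpow_repE !(tpow_liftE ml) (rhoA g).1.
Qed.

Definition schur_one : S 0 := Schur (introT (asboolP _) schur_one_hom).

(* v_1 ... v_(m + n) |-> f (v_1 ... v_m) * h (v_(m + 1) ... v_(m + n)) *)
Definition schur_mul_fun m n (f : S m) (h : S n) : tpow V (m + n) -> A :=
  tpow_lift (fun t => f (tens (tuple_l t)) * h (tens (tuple_r t))).

Lemma tuple_l_cat m n (t : m.-tuple V) (u : n.-tuple V) : tuple_l (cat_tuple t u) = t.
Proof. by apply: eq_from_tnth => i; rewrite tnth_mktuple tnth_lshift. Qed.

Lemma tuple_r_cat m n (t : m.-tuple V) (u : n.-tuple V) : tuple_r (cat_tuple t u) = u.
Proof. by apply: eq_from_tnth => i; rewrite tnth_mktuple tnth_rshift. Qed.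

Lemma cat_tuple_lr m n (t : (m + n).-tuple V) : cat_tuple (tuple_l t) (tuple_r t) = t.
Proof.
apply: eq_from_tnth => i.
by case: (split_ordP i) => j ->; rewrite ?tnth_lshift ?tnth_rshift tnth_mktuple.
Qed.

Let mul_ml m n (f : S m) (h : S n) :
  multilinear (fun t => f (tens (tuple_l t)) * h (tens (tuple_r t))).
Proof.
move=> t i a x y; rewrite -[t]cat_tuple_lr.
case: (split_ordP i) => j ->.
  rewrite -!cat_tsetl !tuple_l_cat !tuple_r_cat tens_multilinear schur_linear.
  by rewrite mulrDl scalerAl.
rewrite -!cat_tsetr !tuple_l_cat !tuple_r_cat tens_multilinear schur_linear.
by rewrite mulrDr scalerAr.
Qed.

Lemma schur_mul_funE m n (f : S m) (h : S n) t :
  schur_mul_fun f h (tens t) = f (tens (tuple_l t)) * h (tens (tuple_r t)).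
Proof. exact: (tpow_liftE (mul_ml f h)). Qed.

Fact schur_mul_hom m n (f : S m) (h : S n) : gl_hom rho (schur_mul_fun f h).
Proof.
have lin : linear (schur_mul_fun f h) := tpow_lift_is_linear (mul_ml f h).
split=> // g; apply: tpow_ext => [||t].
- by move=> a x y; rewrite rep_linear lin.
- by move=> a x y; rewrite lin rep_linear.
rewrite tpow_repE schur_mul_funE schur_mul_funE (rhoA g).2.
rewrite -(schur_equiv f g) -(schur_equiv h g) !tpow_repE.
have -> : tuple_l (map_tuple (gl_std g) t) = map_tuple (gl_std g) (tuple_l t).
  by apply: eq_from_tnth => i; rewrite tnth_mktuple !tnth_map tnth_ord_tuple.
have -> // : tuple_r (map_tuple (gl_std g) t) = map_tuple (gl_std g) (tuple_r t).
by apply: eq_from_tnth => i; rewrite tnth_mktuple !tnth_map tnth_ord_tuple.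
Qed.

Definition schur_mul m n (f : S m) (h : S n) : S (m + n) :=
  Schur (introT (asboolP _) (schur_mul_hom f h)).

Lemma schur_mulE m n (f : S m) (h : S n) t :
  schur_mul f h (tens t) = f (tens (tuple_l t)) * h (tens (tuple_r t)).
Proof. exact: schur_mul_funE. Qed.

Fact schur_act_hom n (s : 'S_n) (f : S n) : gl_hom rho (f \o tpow_act s^-1%g).
Proof.
split=> [a x y|g x]; first by rewrite /comp tpow_act_linear schur_linear.
suff E : tpow_act s^-1%g (tpow_rep gl_std n g x) =
         tpow_rep gl_std n g (tpow_act s^-1%g x).
  by rewrite /comp E; apply: (schur_equiv f g).
apply: (@tpow_ext _ _ _ _ (fun x => tpow_act s^-1%g (tpow_rep gl_std n g x))
  (fun x => tpow_rep gl_std n g (tpow_act s^-1%g x))) => [a u v|a u v|t].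
- by rewrite rep_linear tpow_act_linear.
- by rewrite tpow_act_linear rep_linear.
rewrite tpow_actE !tpow_repE tpow_actE; congr tens; apply: eq_from_tnth => i.
by rewrite tnth_mktuple !tnth_map tnth_ord_tuple.
Qed.

(* (s f) (v_1 ... v_n) = f (v_(s 1) ... v_(s n)); on the weight vector
   f (e_1 ... e_n) this is the action of s by permutation of e_1, ..., e_n *)
Definition schur_act n (s : 'S_n) (f : S n) : S n :=
  Schur (introT (asboolP _) (schur_act_hom s f)).

Lemma schur_actE n (s : 'S_n) (f : S n) t :
  schur_act s f (tens t) = f (tens (tperm_tuple s t)).
Proof. by rewrite /= tpow_actE invgK. Qed.

Lemma schur_linE n a (f h : S n) x : (a *: f + h) x = a *: f x + h x.
Proof. by []. Qed.

Local Notation SA := (fun n => S n : lmodType k).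

Lemma castn_schurE m n (e : m = n) (f : S m) t :
  (castn (A := SA) e f : S n) (tens t) = f (tens (tcast (esym e) t)).
Proof. by case: n / e t => t; rewrite tcast_id. Qed.

Lemma schur_oneE t : schur_one (tens t) = 1.
Proof. by apply: tpow_liftE => u []. Qed.

Lemma schur_act_linear n (s : 'S_n) : linear (@schur_act n s).
Proof. by move=> a f h; apply: schur_ext => t; rewrite schur_linE !schur_actE. Qed.

Lemma schur_act1 n (f : S n) : schur_act 1%g f = f.
Proof.
apply: schur_ext => t; rewrite schur_actE; congr (f (tens _)).
by apply: eq_from_tnth => i; rewrite tnth_mktuple perm1.
Qed.

Lemma schur_actM n (s t : 'S_n) (f : S n) :
  schur_act (s * t)%g f = schur_act t (schur_act s f).
Proof.
apply: schur_ext => u; rewrite !schur_actE; congr (f (tens _)).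
by apply: eq_from_tnth => i; rewrite !tnth_mktuple permM.
Qed.

Lemma schur_mul_linearl m n (h : S n) : linear (fun f : S m => schur_mul f h).
Proof.
move=> a f f'; apply: schur_ext => t.
by rewrite schur_linE !schur_mulE schur_linE mulrDl scalerAl.
Qed.

Lemma schur_mul_linearr m n (f : S m) : linear (fun h : S n => schur_mul f h).
Proof.
move=> a h h'; apply: schur_ext => t.
by rewrite schur_linE !schur_mulE schur_linE mulrDr scalerAr.
Qed.

Let congr_mul m n (f : S m) (h : S n) t t' u u' : t = t' -> u = u' ->
  f (tens t) * h (tens u) = f (tens t') * h (tens u').
Proof. by move=> -> ->. Qed.

Lemma schur_mulA m n p (f : S m) (g : S n) (h : S p) :
  castn (A := SA) (addnA m n p) (schur_mul f (schur_mul g h)) =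
  schur_mul (schur_mul f g) h.
Proof.
apply: schur_ext => t; rewrite castn_schurE !schur_mulE mulrA.
set t1 := tuple_l (tuple_l t); set t2 := tuple_r (tuple_l t); set t3 := tuple_r t.
suff [-> -> -> //] : [/\ tuple_l (tcast (esym (addnA m n p)) t) = t1,
    tuple_l (tuple_r (tcast (esym (addnA m n p)) t)) = t2
  & tuple_r (tuple_r (tcast (esym (addnA m n p)) t)) = t3].
by split; apply: eq_from_tnth => i; rewrite !tnth_mktuple tcastE;
  congr tnth; apply: val_inj; rewrite /= ?addnA.
Qed.

Lemma schur_mul1 n (f : S n) : schur_mul schur_one f = f.
Proof.
apply: schur_ext => t; rewrite schur_mulE schur_oneE mul1r; congr (f (tens _)).
by apply: eq_from_tnth => i; rewrite tnth_mktuple; congr tnth; apply: val_inj.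
Qed.

Lemma schur_mulr1 n (f : S n) : castn (A := SA) (addn0 n) (schur_mul f schur_one) = f.
Proof.
apply: schur_ext => t; rewrite castn_schurE schur_mulE schur_oneE mulr1.
congr (f (tens _)); apply: eq_from_tnth => i.
by rewrite tnth_mktuple tcastE; congr tnth; apply: val_inj.
Qed.

Lemma schur_mul_act m n (s : 'S_m) (t : 'S_n) (f : S m) (h : S n) :
  schur_mul (schur_act s f) (schur_act t h) = schur_act (perm_block s t) (schur_mul f h).
Proof.
apply: schur_ext => u; rewrite schur_actE !schur_mulE !schur_actE.
by apply: congr_mul; apply: eq_from_tnth => i;
  rewrite !tnth_mktuple ?perm_blockl ?perm_blockr.
Qed.

Lemma schur_mulC n m (f : S n) (h : S m) :
  schur_mul f h = castn (A := SA) (addnC m n) (schur_act (tau m n) (schur_mul h f)).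
Proof.
apply: schur_ext => t; rewrite castn_schurE schur_actE !schur_mulE mulrC.
by apply: congr_mul; apply: eq_from_tnth => i;
  rewrite !tnth_mktuple tcastE permE /tau_fun ?(unsplitK (inl _)) ?(unsplitK (inr _));
  congr tnth; apply: val_inj.
Qed.

Definition schur_tca : tca k := {|
  tca_mod n := S n : lmodType k;
  tca_act n s := @schur_act n s;
  tca_one := schur_one;
  tca_mul m n := @schur_mul m n;
  tca_act_linear := schur_act_linear;
  tca_act1 := schur_act1;
  tca_actM := schur_actM;
  tca_mul_linearl := schur_mul_linearl;
  tca_mul_linearr := schur_mul_linearr;
  tca_mulA := schur_mulA;
  tca_mul1 := schur_mul1;
  tca_mulr1 := schur_mulr1;
  tca_mul_act := schur_mul_act;
  tca_mulC := schur_mulC |}.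

End SchurTca.

Section SymWV.
Variables (k : fieldType) (W : lmodType k).

Definition symWV : comAlgType k := sym (tprod W (Vinf k)).

Definition symWV_GL : linrep (GL (Vinf k)) symWV :=
  sym_rep (tprodr_rep W (std_rep (Vinf k))).

Definition symWV_G (G : groupType) (rho : linrep G W) : linrep G symWV :=
  sym_rep (tprodl_rep (Vinf k) rho).

Definition schur_symWV : tca k :=
  schur_tca (sym_rep_alg (tprodr_rep W (std_rep (Vinf k)))).

(* w_1 ... w_n |-> (w_1 (x) e_1) ... (w_n (x) e_n) *)
Definition weight_vector n (w : n.-tuple W) : symWV :=
  \prod_(i < n) sym_in (tprod_in (tnth w i) (ebase k i)).

Definition e_tensor n : tpow (Vinf k) n := tens [tuple ebase k i | i < n].

End SymWV.

Arguments symWV_GL {k} W.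
Arguments schur_symWV {k} W.
Arguments e_tensor k n : clear implicits.

(* Main.v *)
(* A tensor x = w_1 ... w_n defines the equivariant map
     v_1 ... v_n |-> (w_1 (x) v_1) ... (w_n (x) v_n)
   from V^(x)n to S = Sym(W (x) V), and x is recovered from its value at e_1 ... e_n by
   the component of multidegree (1^n). Conversely the value at e_1 ... e_n of an
   equivariant f is a vector of torus weight (1^n), hence, k being infinite, a
   combination of the monomials (w_1 (x) e_1) ... (w_n (x) e_n); and f is determined by
   this value, since e_1 ... e_n generates V^(x)n under transvections. This identifies
   S(S) with R, compatibly with G, which gives (1).
   For (2), a G-invariant y of degree n gives the invariant y(e_1 ... e_n) of S, which is
   a polynomial in elements of U. The torus splits elements of U into weight vectors
   lying in U, and only the products of weight vectors of total weight (1^n) matter. The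
   factors of such a product have squarefree weights with disjoint supports; a factor of
   squarefree weight s is the value at the tensor e_s of an element of S(U), so that the
   product is, up to a permutation, a product in the tca of elements of S(U). *)

Require Import Defs.
From HB Require Import structures.
From mathcomp Require Import all_boot all_algebra all_fingroup.
From mathcomp Require Import boolp classical_sets functions cardinality.
From mathcomp Require Import finmap monalg.

Set Implicit Arguments.
Unset Strict Implicit.
Unset Printing Implicit Defensive.

Import GRing.Theory.
Local Open Scope ring_scope.

(** * Linear algebra and elements of GL *)

Section LinearFun.
Variables (k : fieldType) (M N : lmodType k) (f : M -> N).
Hypothesis lf : linear f.

Lemma lin0 : f 0 = 0.
Proof. by have := lf (-1) 0 0; rewrite !scaler0 addr0 scaleN1r addNr. Qed.

Lemma linZ a x : f (a *: x) = a *: f x.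
Proof. by have := lf a x 0; rewrite !addr0 lin0 addr0. Qed.

Lemma linD x y : f (x + y) = f x + f y.
Proof. by have := lf 1 x y; rewrite !scale1r. Qed.

Lemma linB x y : f (x - y) = f x - f y.
Proof. by rewrite linD -scaleN1r linZ scaleN1r. Qed.

Lemma lin_sum I (r : seq I) (P : pred I) (F : I -> M) :
  f (\sum_(i <- r | P i) F i) = \sum_(i <- r | P i) f (F i).
Proof. exact: (big_morph f linD lin0). Qed.

End LinearFun.

Section Subspace.
Variables (k : fieldType) (M : lmodType k) (U : M -> Prop).
Hypotheses (U0 : U 0) (Ulin : forall a x y, U x -> U y -> U (a *: x + y)).

Lemma subspaceB x y : U x -> U y -> U (x - y).
Proof. by move=> Ux Uy; rewrite addrC -scaleN1r; apply: Ulin. Qed.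

Lemma subspace_sum (I : eqType) (r : seq I) (P : pred I) (F : I -> M) :
  (forall i, i \in r -> P i -> U (F i)) -> U (\sum_(i <- r | P i) F i).
Proof.
move=> UF; rewrite big_seq_cond; apply: big_rec => // i x /andP[ir Pi] Ux.
by rewrite -[F i]scale1r; apply: Ulin => //; apply: UF.
Qed.

End Subspace.

Lemma tset_id (k : fieldType) (M : lmodType k) n (t : n.-tuple M) i :
  tset t i (tnth t i) = t.
Proof. by apply: eq_from_tnth => j; rewrite !tnth_mktuple; case: eqP => [->|]. Qed.

Lemma multilinear_prod (k : fieldType) (M : lmodType k) (A : comAlgType k) n
    (F : 'I_n -> M -> A) :
  (forall i, linear (F i)) -> multilinear (fun t => \prod_i F i (tnth t i)).
Proof.
move=> lF t i a x y; have E z : \prod_j F j (tnth (tset t i z) j) =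
    F i z * \prod_(j | j != i) F j (tnth t j).
  rewrite (bigD1 i) //= tnth_mktuple eqxx; congr (_ * _).
  by apply: eq_bigr => j /negPf ji; rewrite tnth_mktuple ji.
by rewrite !E lF mulrDl -scalerAl.
Qed.

Lemma alg_mul_linearl (k : fieldType) (A : comAlgType k) (y : A) : linear (fun x => x * y).
Proof. by move=> a x x'; rewrite mulrDl -scalerAl. Qed.

Lemma alg_mul_linearr (k : fieldType) (A : comAlgType k) (x : A) : linear (fun y => x * y).
Proof. by move=> a y y'; rewrite mulrDr -scalerAr. Qed.

Section VectorSpace.
Variable k : fieldType.
Local Notation V := (Vinf k).

Definition ecoef (c : nat) (x : V) : k := (x : {malg k[nat]})@_c.

Lemma ecoef_linear c : linear (ecoef c : V -> k^o).
Proof. by move=> a x y; rewrite /ecoef mcoeffD mcoeffZ. Qed.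

Lemma ecoefP c a x y : ecoef c (a *: x + y) = a * ecoef c x + ecoef c y.
Proof. exact: ecoef_linear. Qed.

Lemma ecoefE c i : ecoef c (ebase k i) = (i == c)%:R.
Proof. by rewrite /ecoef /ebase /fbase locked_withE mcoeffU. Qed.

Lemma ecoef_bounded (x : V) : exists N, forall c, (N <= c)%N -> ecoef c x = 0.
Proof.
exists (\max_(i <- msupp (x : {malg k[nat]})) i).+1 => c lt_xc.
apply/eqP; rewrite mcoeff_eq0; apply/negP => cx.
by have := @leq_bigmax_seq _ _ predT id c cx isT; rewrite leqNgt lt_xc.
Qed.

(** Supplies basis vectors outside the supports of all entries, the fresh intermediate vectors of
    [schur_sub_base]. *)
Lemma ecoef_tuple_bounded n (t : n.-tuple V) :
  exists N, forall i c, (N <= c)%N -> ecoef c (tnth t i) = 0.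
Proof.
have [N NP] := choice (fun i => ecoef_bounded (tnth t i)).
by exists (\max_i N i) => i c lt_c; apply/NP/leq_trans/lt_c/leq_bigmax.
Qed.

Lemma Vinf_ind (P : V -> Prop) :
  P 0 -> (forall i, P (ebase k i)) ->
  (forall a x y, P x -> P y -> P (a *: x + y)) -> forall x, P x.
Proof.
move=> P0 Pe Plin x; rewrite [x : {malg k[nat]}]monalgE.
elim: (X in \sum_(_ <- X) _) => [|i s IHs]; first by rewrite big_nil.
rewrite big_cons fbaseZ; exact: (Plin _ _ _ (Pe i) IHs).
Qed.

Section RankOne.
Variables (c : nat) (v : V).

(** One family covers both kinds of elements needed: transvections, when the c-th coordinate of [v]
    is 0, and torus elements, when [v] is [(t - 1) *: ebase k c]. *)
Definition rank1_fun (x : V) : V := x + ecoef c x *: v.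

Hypothesis v_ok : 1 + ecoef c v != 0.

Lemma rank1_gl : gl_pred rank1_fun.
Proof.
apply/asboolP; split=> [a x y|].
  by rewrite /rank1_fun ecoefP scalerDl scalerDr scalerA addrACA.
have cE b x : ecoef c (x + b *: v) = ecoef c x + b * ecoef c v.
  by rewrite addrC ecoefP addrC.
(* The map multiplies the c-th coordinate by [1 + ecoef c v], so dividing by this factor tells which
   multiple of [v] to subtract. *)
exists (fun x => x + (- (ecoef c x / (1 + ecoef c v))) *: v) => x;
  rewrite /rank1_fun cE -addrA -scalerDl.
  rewrite -{2}[ecoef c x]mulr1 -mulrDr mulfK // subrr scale0r addr0 //.
have eE : ecoef c x = ecoef c x / (1 + ecoef c v) * (1 + ecoef c v).
  by rewrite divfK.
by rewrite {2}eE mulrDr mulr1 mulNr addrK addNr scale0r addr0.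
Qed.

Definition rank1 : GL V := MkGL rank1_gl.

Lemma rank1E x : std_rep V rank1 x = x + ecoef c x *: v.
Proof. by []. Qed.

End RankOne.
End VectorSpace.

(* The GL-translates of a pure tensor of distinct basis vectors span the tensor
   power: transvections replace its factors one at a time, first by basis vectors
   outside the support of v and then by the entries of v. *)
Section Transvections.
Variables (k : fieldType) (M : lmodType k) (rho : linrep (GL (Vinf k)) M).
Variables (U : M -> Prop) (n : nat) (f : schur rho n).
Hypothesis Usub : is_subrep rho U.
Local Notation V := (Vinf k).

(** The transvection x |-> x + x_c v changes only the factor in slot [i], from e_c to e_c + v; the
    difference of the two tensors has [v] in that slot. *)
Lemma transv_slot (t : n.-tuple V) i c v :
  tnth t i = ebase k c -> (forall j, j != i -> ecoef c (tnth t j) = 0) ->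
  ecoef c v = 0 -> U (f (tens t)) -> U (f (tens (tset t i v))).
Proof.
have [U0 Ulin Urho] := Usub.
move=> ti tj cv Ut; have v_ok : 1 + ecoef c v != 0 by rewrite cv addr0 oner_neq0.
have := subspaceB Ulin (Urho (rank1 v_ok) _ Ut) Ut.
rewrite -schur_equiv tpow_repE.
have -> : map_tuple (std_rep V (rank1 v_ok)) t = tset t i (1 *: v + ebase k c).
  apply: eq_from_tnth => j; rewrite tnth_map tnth_mktuple rank1E.
  case: eqP => [->|/eqP/tj ->]; last by rewrite scale0r addr0.
  by rewrite ti ecoefE eqxx addrC.
rewrite tens_multilinear -ti tset_id scale1r linD ?addrK //.
exact: schur_linear.
Qed.

Lemma transv_chain (c : n.-tuple nat) (v : n.-tuple V) :
  uniq c -> (forall i j, ecoef (tnth c i) (tnth v j) = 0) ->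
  U (f (tens (map_tuple (ebase k) c))) -> U (f (tens v)).
Proof.
move=> c_uniq cv Uc.
(* The first [m] factors have already been replaced by those of [v]. *)
pose t m : n.-tuple V := [tuple if (i < m)%N then tnth v i else ebase k (tnth c i) | i < n].
have t0 : t 0 = map_tuple (ebase k) c.
  by apply: eq_from_tnth => i; rewrite tnth_mktuple tnth_map.
have tn : t n = v by apply: eq_from_tnth => i; rewrite tnth_mktuple ltn_ord.
suff Ut m : (m <= n)%N -> U (f (tens (t m))) by rewrite -tn; apply: Ut.
elim: m => [|m IHm] mn; first by rewrite t0.
pose i := Ordinal mn.
have -> : t m.+1 = tset (t m) i (tnth v i).
  apply: eq_from_tnth => j; rewrite !tnth_mktuple ltnS leq_eqVlt -(inj_eq val_inj) /=.
  by case: eqP => // /esym ji; congr (tnth v); apply: val_inj.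
apply: (transv_slot (c := tnth c i)); rewrite ?tnth_mktuple ?ltnn //; last exact/IHm/ltnW.
(* The index [tnth c i] is absent from every other factor: from entries of [v] by [cv], from the
   remaining basis vectors because [c] has no repetitions. *)
move=> j ji; rewrite tnth_mktuple; case: ifP => // _.
rewrite ecoefE !(tnth_nth 0) nth_uniq ?size_tuple ?(ltn_ord j) //.
by rewrite -[_ == _ :> nat]/(j == i) (negPf ji).
Qed.

(** A single chain from [s] to [v] would require [v] to avoid the indices of [s]; hence two chains,
    through fresh basis vectors. *)
Lemma schur_sub_base (s : n.-tuple nat) :
  uniq s -> U (f (tens (map_tuple (ebase k) s))) -> schur_sub U f.
Proof.
have [U0 Ulin _] := Usub; have lf := schur_linear f.
move=> s_uniq Us; apply: pres_ind => [|v|a x y Ux Uy]; first by rewrite lin0.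
  rewrite -/(tens v); have [N vN] := ecoef_tuple_bounded v.
  (* [K] lies beyond the supports of the entries of [v] and beyond all entries of [s]. *)
  pose K := maxn N (\max_(i < n) tnth s i).+1.
  pose c : n.-tuple nat := [tuple K + i | i < n]%N.
  have Kc i : (K <= tnth c i)%N by rewrite tnth_mktuple leq_addr.
  apply: (@transv_chain c).
  - by rewrite map_inj_uniq ?enum_uniq // => i j /addnI/val_inj.
  - by move=> i j; apply/vN/leq_trans/Kc; rewrite leq_maxl.
  apply: (transv_chain s_uniq) => // i j.
  rewrite tnth_map ecoefE; case: eqP => // ji.
  have := Kc j; rewrite ji geq_max ltnNge => /andP[_].
  by rewrite (leq_bigmax i).
by rewrite lf; apply: Ulin.
Qed.

End Transvections.

(** * Linear maps out of symmetric powers *)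

(* A multilinear map B on M^n induces a linear map on Sym(M): symmetrise B on
   products of n elements of M, and send products of other lengths to 0. *)
Section Symmetrization.
Variables (k : fieldType) (M N : lmodType k) (n : nat) (B : n.-tuple M -> N).
Hypothesis Bm : multilinear B.

(** The sum is not divided by n!, so it makes sense in every characteristic. *)
Definition symz (s : seq M) : N :=
  if size s == n then \sum_(p : 'S_n) B [tuple nth 0 s (p i) | i < n] else 0.

(** Reindexing the sum over ['S_n] absorbs the permutation; hence [symz] depends only on the
    commutative monomial. *)
Lemma symz_perm s s' : perm_eq s s' -> symz s = symz s'.
Proof.
move=> ss'; rewrite /symz (perm_size ss'); case: eqP => // s'n.
pose t := tcast s'n (in_tuple s').
have tE i : tnth t i = nth 0 s' i by rewrite (tnth_nth 0) val_tcast.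
have /tuple_permP[q sE] : perm_eq s t by rewrite val_tcast.
rewrite (reindex_inj (mulIg q^-1%g)) /=; apply: eq_bigr => p _; congr B.
apply: eq_from_tnth => i; rewrite !tnth_mktuple sE -tnth_nth tnth_mktuple tE.
by rewrite permM permKV.
Qed.

Lemma symz_cons s : linear (fun x => symz (x :: s)).
Proof.
move=> a x y; rewrite /symz /=; case: eqP => [sn|_]; last by rewrite scaler0 addr0.
have lt0n : (0 < n)%N by rewrite -sn.
rewrite scaler_sumr -big_split /=; apply: eq_bigr => p _.
(* In the summand of [p] the first letter occupies the single slot [p^-1 0]; the head 0 on the right
   is a placeholder overwritten by [tset]. *)
have E z : [tuple nth 0 (z :: s) (p i) | i < n] =
    tset [tuple nth 0 (0 :: s) (p i) | i < n] (p^-1%g (Ordinal lt0n)) z.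
  apply: eq_from_tnth => i; rewrite !tnth_mktuple -(can2_eq (permK p) (permKV p)).
  by rewrite -(inj_eq val_inj) /=; case: (nat_of_ord (p i)).
by rewrite (E (_ + _)) (E x) (E y) Bm.
Qed.

Definition cmon_enum (m : {cmonom M}) : seq M :=
  flatten [seq nseq (m x) x | x <- finsupp m].

Lemma count_cmon_enum (m : {cmonom M}) x : count_mem x (cmon_enum m) = m x.
Proof.
rewrite /cmon_enum count_flatten -map_comp sumnE big_map.
have [xm|xm] := boolP (x \in finsupp m).
  rewrite (bigD1_seq x) ?fset_uniq //= count_nseq /= eqxx mul1n big1 ?addn0 // => y.
  by rewrite count_nseq /= => /negPf ->.
have -> : m x = 0%N by apply/eqP; rewrite cmE_eq0.
rewrite big_seq big1 // => y ym; rewrite /= count_nseq /=.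
by case: eqP => // yx; move: xm; rewrite -yx ym.
Qed.

Lemma symz_cmon_enum (m : {cmonom M}) x :
  symz (cmon_enum (mmul m (ucm x))) = symz (x :: cmon_enum m).
Proof.
apply: symz_perm; apply/allP => /= y _.
by rewrite /= !count_cmon_enum cmM cmU addnC.
Qed.

Definition symz_ev : {malg k[{cmonom M}]} -> N := flift (symz \o cmon_enum).

(** Multiplication by a generator prepends a letter to each word, which reduces the relations of
    [sym] to linearity of [symz] in its first letter. *)
Lemma symz_evM (q : {malg k[{cmonom M}]}) (u : M) :
  symz_ev (q * sym_var u) = flift (fun m => symz (u :: cmon_enum m)) q.
Proof.
apply: (@free_ext _ _ _ (fun q : {malg k[{cmonom M}]} => symz_ev (q * sym_var u))
  (flift (fun m => symz (u :: cmon_enum m)))) q => [a x y|a x y|m].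
- by rewrite mulrDl -scalerAl; exact: flift_is_linear.
- exact: flift_is_linear.
have -> : fbase k m * sym_var u = fbase k (mmul m (ucm u)) := fbaseM k m (ucm u).
by rewrite /symz_ev !fliftU; exact: symz_cmon_enum.
Qed.

Lemma symz_ev_rel p : sym_rel p -> symz_ev p = 0.
Proof.
have ev_lin : linear symz_ev := flift_is_linear _.
case=> q a x y.
have comb (u v w : {malg k[{cmonom M}]}) :
    symz_ev (q * u) = a *: symz_ev (q * v) + symz_ev (q * w) ->
    symz_ev (q * (u - (a *: v + w))) = 0.
  have mulZ : q * (a *: v) = a *: (q * v) by rewrite mulrC -scalerAl mulrC.
  rewrite mulrBr mulrDr mulZ (linB ev_lin) ev_lin => /eqP.
  by rewrite -subr_eq0 => /eqP.
apply: comb; apply: etrans (symz_evM q _) _.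
transitivity (a *: flift (fun m => symz (x :: cmon_enum m)) q
    + flift (fun m => symz (y :: cmon_enum m)) q); last first.
  by congr (_ *: _ + _); symmetry; apply: symz_evM.
apply: (@free_ext _ _ _ (flift (fun m => symz ((a *: x + y) :: cmon_enum m)))
  (fun q => a *: flift (fun m => symz (x :: cmon_enum m)) q
    + flift (fun m => symz (y :: cmon_enum m)) q)) q => [|| m].
- exact: flift_is_linear.
- exact: linear_comb (flift_is_linear _) (flift_is_linear _).
by rewrite !fliftU symz_cons.
Qed.

Definition symz_lift : sym M -> N := qlift symz_ev.

Lemma symz_lift_linear : linear symz_lift.
Proof. exact: (qlift_is_linear symz_ev_rel). Qed.

Lemma symz_liftE (s : seq M) : symz_lift (\prod_(x <- s) sym_in x) = symz s.
Proof.
(* A product of generators is the class of one monomial, whose word is a rearrangement of [s]. *)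
have [m mE ms] : exists2 m : {cmonom M},
    \prod_(x <- s) sym_in x = qpi (@sym_rel k M) (fbase k m) & perm_eq (cmon_enum m) s.
  elim: s => [|x s [m mE ms]].
    exists (@mone _); first by rewrite big_nil /fbase locked_withE [LHS]locked_withE.
    by apply/allP => /= y _; rewrite /= count_cmon_enum cm1.
  exists (mmul (ucm x) m).
    by rewrite big_cons mE -fbaseM sym_piM.
  apply: perm_trans (_ : perm_eq _ (x :: cmon_enum m)) _; last by rewrite perm_cons.
  by apply/allP => /= y _; rewrite /= !count_cmon_enum cmM cmU.
rewrite mE; apply: etrans (qliftE symz_ev_rel _) _.
by apply: etrans (fliftU _ _) _; apply: symz_perm.
Qed.

End Symmetrization.

(** * From tensors to the Schur functor *)

(* pair_prod and tpow_pair are locked because unification and rewriting diverge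
   when they unfold into the symmetric algebra. *)
HB.lock Definition pair_prod (k : fieldType) (W : lmodType k) n
    (w : n.-tuple W) (v : n.-tuple (Vinf k)) : symWV W :=
  \prod_i sym_in (tprod_in (tnth w i) (tnth v i)).

(* w_1 ... w_n, v_1 ... v_n |-> (w_1 (x) v_1) ... (w_n (x) v_n) *)
HB.lock Definition tpow_pair (k : fieldType) (W : lmodType k) n
    (x : tpow W n) (y : tpow (Vinf k) n) : symWV W :=
  tpow_lift (fun w : n.-tuple W => tpow_lift (pair_prod w) y) x.

Section WeightProduct.
Variables (k : fieldType) (W : lmodType k).
Local Notation V := (Vinf k).
Local Notation S := (symWV W).

Lemma sym_in_tprodl v : linear (fun w => sym_in (tprod_in w v) : S).
Proof. by move=> a x y; rewrite tprod_in_linearl linearP. Qed.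

Lemma sym_in_tprodr w : linear (fun v => sym_in (tprod_in w v) : S).
Proof. by move=> a x y; rewrite tprod_in_linearr linearP. Qed.

Lemma pair_prod_mll n (v : n.-tuple V) : multilinear (fun w : n.-tuple W => pair_prod w v).
Proof.
rewrite pair_prod.unlock.
exact: (@multilinear_prod _ _ _ _ (fun i w => sym_in (tprod_in w (tnth v i)))
  (fun i => sym_in_tprodl (tnth v i))).
Qed.

Lemma pair_prod_mlr n (w : n.-tuple W) : multilinear (pair_prod w).
Proof.
rewrite pair_prod.unlock.
exact: (@multilinear_prod _ _ _ _ (fun i v => sym_in (tprod_in (tnth w i) v))
  (fun i => sym_in_tprodr (tnth w i))).
Qed.

Let pair_ml n (y : tpow V n) : multilinear (fun w : n.-tuple W => tpow_lift (pair_prod w) y).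
Proof.
move=> t i a x x'; have lin (w : n.-tuple W) := tpow_lift_is_linear (pair_prod_mlr w).
apply: (tpow_ext (lin _) (linear_comb a (lin _) (lin _))) => v.
have E (w : n.-tuple W) := tpow_liftE (pair_prod_mlr w) v.
rewrite E E E; exact: (pair_prod_mll v t i a x x').
Qed.

Lemma tpow_pairE n (w : n.-tuple W) (v : n.-tuple V) :
  tpow_pair (tens w) (tens v) = pair_prod w v.
Proof.
rewrite tpow_pair.unlock.
exact: etrans (tpow_liftE (pair_ml _) _) (tpow_liftE (pair_prod_mlr _) _).
Qed.

Lemma tpow_pair_linearl n (y : tpow V n) : linear (fun x : tpow W n => tpow_pair x y).
Proof. by rewrite tpow_pair.unlock; exact: (tpow_lift_is_linear (pair_ml y)). Qed.

Lemma tpow_pair_linearr n (x : tpow W n) : linear (tpow_pair x : tpow V n -> S).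
Proof.
move=> a y y'; have lin (z : tpow V n) := @tpow_pair_linearl n z.
apply: (tpow_ext (lin _) (linear_comb a (lin _) (lin _))) => w.
have E (z : tpow V n) : tpow_pair (tens w) z = tpow_lift (pair_prod w) z.
  by rewrite tpow_pair.unlock; exact: (tpow_liftE (pair_ml z) w).
by rewrite E E E (tpow_lift_is_linear (pair_prod_mlr w)).
Qed.

Lemma tpow_pair_ext (N : lmodType k) n (f g : tpow W n -> tpow V n -> N) :
  (forall y, linear (f^~ y)) -> (forall x, linear (f x)) ->
  (forall y, linear (g^~ y)) -> (forall x, linear (g x)) ->
  (forall w v, f (tens w) (tens v) = g (tens w) (tens v)) -> f =2 g.
Proof.
move=> fl fr gl gr fg x y; apply: (tpow_ext (fl y) (gl y)) => w.
exact: (tpow_ext (fr _) (gr _)).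
Qed.

(** Serves both actions on [S]: that of [GL] with [f = id] and that of [G] with [g = id]. *)
Lemma pair_prod_map (R : S -> S) n (w : n.-tuple W) (v : n.-tuple V)
    (f : W -> W) (g : V -> V) :
  R 1 = 1 -> {morph R : x y / x * y} ->
  (forall w v, R (sym_in (tprod_in w v)) = sym_in (tprod_in (f w) (g v))) ->
  R (pair_prod w v) = pair_prod (map_tuple f w) (map_tuple g v).
Proof.
move=> R1 RM Rin; rewrite pair_prod.unlock (big_morph R RM R1).
by apply: eq_bigr => i _; rewrite Rin !tnth_map.
Qed.

Fact tpow_pair_hom n (x : tpow W n) : gl_hom (symWV_GL W) (tpow_pair x).
Proof.
split=> [|g y]; first exact: tpow_pair_linearr.
apply: (@tpow_pair_ext _ _ (fun x y => tpow_pair x (tpow_rep (std_rep V) n g y))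
  (fun x y => symWV_GL W g (tpow_pair x y))) => {x y} [y|x|y|x|w v].
- exact: tpow_pair_linearl.
- by move=> a y y'; rewrite rep_linear tpow_pair_linearr.
- by move=> a x x'; rewrite tpow_pair_linearl rep_linear.
- by move=> a y y'; rewrite tpow_pair_linearr rep_linear.
have [R1 RM] := sym_rep_alg (tprodr_rep W (std_rep V)) g.
rewrite tpow_repE !tpow_pairE (@pair_prod_map (symWV_GL W g) _ _ _ id (std_rep V g)) //.
  by congr pair_prod; apply: eq_from_tnth => i; rewrite tnth_map.
by move=> w' v'; rewrite [LHS]sym_rep_in [tprodr_rep _ _ _ _]tprodr_funE.
Qed.

Definition schur_of n (x : tpow W n) : schur (symWV_GL W) n :=
  Defs.Schur (introT (asboolP _) (tpow_pair_hom x)).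

Lemma schur_ofE n (x : tpow W n) y : schur_of x y = tpow_pair x y.
Proof. by []. Qed.

Lemma tpow_pair_G (G : groupType) (rho : linrep G W) n g (x : tpow W n) y :
  tpow_pair (tpow_rep rho n g x) y = symWV_G rho g (tpow_pair x y).
Proof.
apply: (@tpow_pair_ext _ _ (fun x y => tpow_pair (tpow_rep rho n g x) y)
  (fun x y => symWV_G rho g (tpow_pair x y))) => {x y} [y|x|y|x|w v].
- by move=> a x x'; rewrite rep_linear tpow_pair_linearl.
- exact: tpow_pair_linearr.
- by move=> a x x'; rewrite tpow_pair_linearl rep_linear.
- by move=> a y y'; rewrite tpow_pair_linearr rep_linear.
have [R1 RM] := sym_rep_alg (tprodl_rep V rho) g.
rewrite tpow_repE !tpow_pairE (@pair_prod_map (symWV_G rho g) _ _ _ (rho g) id) //.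
  by congr pair_prod; apply: eq_from_tnth => i; rewrite tnth_map.
by move=> w' v'; rewrite [LHS]sym_rep_in [tprodl_rep _ _ _ _]tprodl_funE.
Qed.

(** Reindexing the commutative product by [s] moves the permutation from the factors in [W] to those
    in [V]. *)
Lemma pair_prod_perm n (s : 'S_n) (w : n.-tuple W) v :
  pair_prod (tperm_tuple s^-1%g w) v = pair_prod w (tperm_tuple s v).
Proof.
have E (F H : 'I_n -> S) : (forall i, F (s i) = H i) -> \prod_i F i = \prod_i H i.
  by move=> FH; rewrite (reindex_inj (@perm_inj _ s)); apply: eq_bigr => i _.
have E1 i : tnth (tperm_tuple s^-1%g w) (s i) = tnth w i by rewrite tnth_mktuple permK.
have E2 i : tnth v (s i) = tnth (tperm_tuple s v) i by rewrite tnth_mktuple.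
rewrite pair_prod.unlock; apply: E => i.
by rewrite E1 E2.
Qed.

Lemma tpow_pair_act n (s : 'S_n) (x : tpow W n) v :
  tpow_pair (tpow_act s x) (tens v) = tpow_pair x (tens (tperm_tuple s v)).
Proof.
apply: (@tpow_ext _ _ _ _ (fun x => tpow_pair (tpow_act s x) (tens v))
  (fun x => tpow_pair x (tens (tperm_tuple s v)))) => [a y z||w].
- by rewrite tpow_act_linear tpow_pair_linearl.
- exact: tpow_pair_linearl.
rewrite tpow_actE; apply: etrans (tpow_pairE _ _) _.
apply: etrans (pair_prod_perm s w v) _; symmetry; exact: tpow_pairE.
Qed.

Lemma pair_prod_cat m n (w : m.-tuple W) (w' : n.-tuple W) v v' :
  pair_prod (cat_tuple w w') (cat_tuple v v') = pair_prod w v * pair_prod w' v'.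
Proof.
have E (F : 'I_(m + n) -> S) G H : (forall i, F (lshift n i) = G i) ->
    (forall i, F (rshift m i) = H i) -> \prod_i F i = (\prod_i G i) * (\prod_i H i).
  by move=> FG FH; rewrite big_split_ord; congr (_ * _); apply: eq_bigr => i _.
rewrite pair_prod.unlock; apply: E => i; first by rewrite !tnth_lshift.
by rewrite !tnth_rshift.
Qed.

Lemma tpow_pair_mul m n (x : tpow W m) (y : tpow W n) v v' :
  tpow_pair (tpow_mul x y) (tens (cat_tuple v v')) =
    tpow_pair x (tens v) * tpow_pair y (tens v').
Proof.
apply: (@tpow_ext _ _ _ _ (fun x => tpow_pair (tpow_mul x y) (tens (cat_tuple v v')))
  (fun x => tpow_pair x (tens v) * tpow_pair y (tens v'))) => [a x1 x2|a x1 x2|w].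
- by rewrite tpow_mul_linearl tpow_pair_linearl.
- by rewrite tpow_pair_linearl; exact: alg_mul_linearl.
apply: (@tpow_ext _ _ _ _ (fun y => tpow_pair (tpow_mul (tens w) y) (tens (cat_tuple v v')))
  (fun y => tpow_pair (tens w) (tens v) * tpow_pair y (tens v'))) => [a x1 x2|a x1 x2|w'].
- by rewrite tpow_mul_linearr tpow_pair_linearl.
- by rewrite tpow_pair_linearl; exact: alg_mul_linearr.
rewrite tpow_mulE; apply: etrans (tpow_pairE _ _) _.
apply: etrans (pair_prod_cat w w' v v') _.
by congr (_ * _); symmetry; apply: tpow_pairE.
Qed.

Lemma schur_of_act n (s : 'S_n) (x : tpow W n) :
  schur_of (tpow_act s x) = tca_act (schur_symWV W) s (schur_of x).
Proof.
apply: (@schur_ext _ _ (symWV_GL W)) => t; rewrite [RHS]schur_actE !schur_ofE.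
exact: tpow_pair_act.
Qed.

Lemma schur_of_one : schur_of (tens [tuple]) = tca_one (schur_symWV W).
Proof.
apply: (@schur_ext _ _ (symWV_GL W)) => t; rewrite [RHS]schur_oneE schur_ofE tpow_pairE.
by rewrite pair_prod.unlock big_ord0.
Qed.

Lemma schur_of_mul m n (x : tpow W m) (y : tpow W n) :
  schur_of (tpow_mul x y) = tca_mul (schur_symWV W) (schur_of x) (schur_of y).
Proof.
apply: (@schur_ext _ _ (symWV_GL W)) => t; rewrite [RHS]schur_mulE !schur_ofE.
by rewrite -tpow_pair_mul cat_tuple_lr.
Qed.

Lemma tpow_pair_e n (w : n.-tuple W) : tpow_pair (tens w) (e_tensor k n) = weight_vector w.
Proof. 
have E (F H : 'I_n -> S) : (forall i, F i = H i) -> \prod_i F i = \prod_i H i.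
  by move=> FH; apply: eq_bigr => i _.
by apply: etrans (tpow_pairE _ _) _; rewrite pair_prod.unlock; apply: E => i; rewrite tnth_mktuple.
 Qed.

(** * Recovering a tensor from its value at e_1 ... e_n *)

Definition tprod_coord (c : nat) : tprod W V -> W :=
  tprod_lift (fun w v => ecoef c v *: w).

Let coordl c (v : V) : linear (fun w : W => ecoef c v *: w).
Proof. by move=> a x y; rewrite scalerDr !scalerA mulrC. Qed.
Let coordr c (w : W) : linear (fun v => ecoef c v *: w).
Proof. by move=> a x y; rewrite ecoefP scalerDl scalerA. Qed.

Lemma tprod_coordE c w v : tprod_coord c (tprod_in w v) = ecoef c v *: w.
Proof. exact: (tprod_liftE (coordl c) (coordr c)). Qed.

Lemma tprod_coord_linear c : linear (tprod_coord c).
Proof. exact: (tprod_lift_is_linear (coordl c) (coordr c)). Qed.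

Definition coord_tens n (t : n.-tuple (tprod W V)) : tpow W n :=
  tens [tuple tprod_coord i (tnth t i) | i < n].

Lemma coord_tens_ml n : multilinear (@coord_tens n).
Proof.
move=> t i a x y.
have E z : coord_tens (tset t i z) =
    tens (tset [tuple tprod_coord i (tnth t i) | i < n] i (tprod_coord i z)).
  congr tens; apply: eq_from_tnth => j; rewrite !tnth_mktuple.
  by case: eqP => [->|].
by rewrite !E tprod_coord_linear tens_multilinear.
Qed.

(* Picks out the component of multidegree (1^n): on (w_1 (x) e_1) ... (w_n (x) e_n)
   only the identity permutation contributes to the symmetrisation. *)
Definition weight_coord n : S -> tpow W n := symz_lift (@coord_tens n).

Lemma weight_coord_linear n : linear (@weight_coord n).
Proof. exact: (symz_lift_linear (@coord_tens_ml n)). Qed.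

Lemma tens0 n (t : n.-tuple W) i : tnth t i = 0 -> tens t = 0.
Proof.
move=> ti; rewrite -(tset_id t i) ti.
exact: (lin0 (tens_multilinear t i)).
Qed.

Lemma weight_coord_vector n (w : n.-tuple W) : weight_coord n (weight_vector w) = tens w.
Proof.
have [s sE] : exists s : n.-tuple (tprod W V), forall i,
    tnth s i = tprod_in (tnth w i) (ebase k i).
  by exists [tuple tprod_in (tnth w i) (ebase k i) | i < n] => i; rewrite tnth_mktuple.
have -> : weight_vector w = \prod_(x <- s) sym_in x.
  by rewrite big_tuple; apply: eq_bigr => i _; rewrite sE.
rewrite /weight_coord symz_liftE; last exact: coord_tens_ml.
rewrite /symz size_tuple eqxx (bigD1 1%g) //= big1 ?addr0.
  congr tens; apply: eq_from_tnth => i; rewrite !tnth_mktuple perm1 -tnth_nth sE.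
  by rewrite tprod_coordE ecoefE eqxx scale1r.
(* If [p] moves [i], slot [i] receives the e_i-coordinate of a vector w (x) e_(p i), which is 0. *)
move=> p p1; have [i pi] : exists i, p i != i.
  apply: contrapT => /forallNP h; case/eqP: p1; apply/permP => i; rewrite perm1.
  by apply/eqP/negPn/negP/h.
apply: (tens0 (i := i)); rewrite !tnth_mktuple -tnth_nth sE tprod_coordE ecoefE.
by rewrite (inj_eq val_inj) (negPf pi) scale0r.
Qed.

Lemma weight_coord_pair n (x : tpow W n) : weight_coord n (tpow_pair x (e_tensor k n)) = x.
Proof.
apply: (@tpow_ext _ _ _ _ (fun x => weight_coord n (tpow_pair x (e_tensor k n))) id) => //.
  by move=> a y z; rewrite tpow_pair_linearl weight_coord_linear.
by move=> w; rewrite tpow_pair_e weight_coord_vector.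
Qed.

End WeightProduct.

(** * Torus weights *)

Section Separation.
Variables (k : fieldType) (k_infinite : infinite_set [set: k]%classic).

(** A nonzero polynomial over an infinite field has a non-root. *)
Lemma exp_separates (a b : nat) : a <> b -> exists2 t : k, t != 0 & t ^+ a != t ^+ b.
Proof.
move=> ab; apply: contrapT => h.
(* The extra factor ['X] forces a non-root to be nonzero. *)
pose p : {poly k} := 'X * ('X^a - 'X^b).
have p0 : p != 0.
  rewrite mulf_neq0 ?polyX_eq0 // subr_eq0; apply/eqP => /(congr1 (coefp a)).
  by rewrite /= !coefXn eqxx; case: eqP => // _ /eqP; rewrite oner_eq0.
have [B _] := infinite_set_fset (size p) k_infinite.
rewrite leqNgt max_poly_roots ?fset_uniq //; apply/allP => t _.
apply/negPn/negP; rewrite /root /p !hornerE mulf_eq0 negb_or subr_eq0.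
by case/andP => t0 tab; apply: h; exists t.
Qed.

End Separation.

Section Torus.
Variable k : fieldType.
Local Notation V := (Vinf k).

Lemma torus_ok i (t : k) : t != 0 -> 1 + ecoef i ((t - 1) *: ebase k i) != 0.
Proof.
have -> : ecoef i ((t - 1) *: ebase k i) = t - 1.
  by rewrite (linZ (ecoef_linear i)) ecoefE eqxx; apply: mulr1.
by rewrite addrC subrK.
Qed.

(* e_i |-> t e_i, fixing the other basis vectors *)
Definition torus i (t : k) (t0 : t != 0) : GL V := rank1 (torus_ok i t0).

Lemma torusE i (t : k) (t0 : t != 0) j :
  std_rep V (torus i t0) (ebase k j) = t ^+ (j == i) *: ebase k j.
Proof.
rewrite rank1E ecoefE; case: eqP => [->|_]; last by rewrite scale0r addr0 scale1r.
by rewrite scale1r scalerBl scale1r addrC subrK.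
Qed.

End Torus.

(** Each term carries a label, a weight listed with multiplicities, so that the terms of one weight
    can be picked out later. Labels may repeat. *)
Definition weighted_sum (M : nmodType) (Q : seq nat -> M -> Prop) (u : M) : Prop :=
  exists2 r : seq (seq nat * M), {in r, forall p, Q p.1 p.2} & u = \sum_(p <- r) p.2.

Section WeightedSum.
Variables (k : fieldType) (M : lmodType k).
Implicit Types Q : seq nat -> M -> Prop.

Lemma weighted_sum1 Q s u : Q s u -> weighted_sum Q u.
Proof. by exists [:: (s, u)] => [p|]; rewrite ?inE ?big_seq1 // => /eqP ->. Qed.

Lemma weighted_sum_lin Q a u v : (forall s b x, Q s x -> Q s (b *: x)) ->
  weighted_sum Q u -> weighted_sum Q v -> weighted_sum Q (a *: u + v).
Proof.
move=> QZ [r rQ ->] [r' r'Q ->]; exists ([seq (p.1, a *: p.2) | p <- r] ++ r') => [p|].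
  by rewrite mem_cat => /orP[/mapP[q /rQ qQ ->]|/r'Q //]; apply: QZ.
by rewrite big_cat big_map scaler_sumr.
Qed.

Lemma weighted_sum_map (N : lmodType k) Q (Q' : seq nat -> N -> Prop) (f : M -> N) u :
  linear f -> (forall s x, Q s x -> weighted_sum Q' (f x)) ->
  weighted_sum Q u -> weighted_sum Q' (f u).
Proof.
move=> lf QQ' [r rQ ->]; rewrite (lin_sum lf).
elim: r rQ => [|p r IHr] rQ; first by rewrite big_nil; exists [::]; rewrite ?big_nil.
rewrite big_cons.
have [q rq pE] := QQ' _ _ (rQ p (mem_head _ _)).
have [|q' rq' ->] := IHr; first by move=> p' p'r; apply: rQ; rewrite inE p'r orbT.
by rewrite pE -big_cat; exists (q ++ q') => // x; rewrite mem_cat => /orP[/rq|/rq'].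
Qed.

End WeightedSum.

Section Weights.
Variables (k : fieldType) (k_infinite : infinite_set [set: k]%classic).
Variables (M : lmodType k) (rho : linrep (GL (Vinf k)) M).

(* the multiplicities in s are the exponents of the character *)
Definition weight (s : seq nat) (a : M) : Prop :=
  forall i t (t0 : t != 0), rho (torus i t0) a = t ^+ count_mem i s *: a.

Lemma weightZ s a x : weight s x -> weight s (a *: x).
Proof. by move=> wx i t t0; rewrite linearZ /= wx !scalerA mulrC. Qed.

Lemma weight_perm s s' a : perm_eq s s' -> weight s a -> weight s' a.
Proof. by move=> /seq.permP ss' wa i t t0; rewrite wa ss'. Qed.

(* acts as the identity on weight mu and kills weight s when b = t ^+ count_mem i s *)
Definition weight_step mu i t (t0 : t != 0) b (z : M) : M :=
  (t ^+ count_mem i mu - b)^-1 *: (rho (torus i t0) z - b *: z).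

Lemma weight_step_linear mu i t (t0 : t != 0) b : linear (weight_step mu i t0 b).
Proof.
move=> a x y; rewrite /weight_step linearP scalerA mulrC -scalerA -scalerDr; congr (_ *: _).
by rewrite !scalerDr scalerN opprD addrACA !scalerA (mulrC a).
Qed.

Lemma weight_stepE mu i t (t0 : t != 0) b s z : weight s z ->
  weight_step mu i t0 b z =
    ((t ^+ count_mem i mu - b)^-1 * (t ^+ count_mem i s - b)) *: z.
Proof. by move=> wz; rewrite /weight_step wz -scalerBl scalerA. Qed.

Definition step_closed mu (P : M -> Prop) := forall i t (t0 : t != 0) b z,
  b != t ^+ count_mem i mu -> P z -> P (weight_step mu i t0 b z).

Lemma step_closed_subrep mu (U : M -> Prop) : is_subrep rho U -> step_closed mu U.
Proof.
move=> Usub i t t0 b z _ Uz; have [U0 Ulin Urho] := Usub; rewrite /weight_step.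
have UZ a x : U x -> U (a *: x) by move=> Ux; rewrite -[_ *: _]addr0; apply: Ulin.
by apply/UZ/(subspaceB Ulin); [apply: Urho|apply: UZ].
Qed.

Lemma step_closed_weight mu u : weight mu u -> step_closed mu (eq u).
Proof.
move=> wu i t t0 b z bc <-; rewrite (weight_stepE _ _ _ _ wu) mulVf ?scale1r //.
by rewrite subr_eq0 eq_sym.
Qed.

Lemma weight_separates (s mu : seq nat) : ~~ perm_eq s mu ->
  exists i (t : k), t != 0 /\ t ^+ count_mem i s != t ^+ count_mem i mu.
Proof.
move=> smu; have [i si] : exists i, count_mem i s <> count_mem i mu.
  apply: contrapT => /forallNP h; case/negP: smu; apply/allP => i _ /=.
  by apply/eqP; apply: contrapT; exact: h.
have [t t0 ti] := exp_separates k_infinite si.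
by exists i, t.
Qed.

(* Only the closure of P under weight_step is used, so that this applies both to a
   subrepresentation P and to P := eq u for a vector u of weight mu. *)
Lemma weight_select mu (P : M -> Prop) (r : seq (seq nat * M)) :
  step_closed mu P -> {in r, forall p, weight p.1 p.2} ->
  P (\sum_(p <- r) p.2) -> P (\sum_(p <- r | perm_eq p.1 mu) p.2).
Proof.
(* The induction needs an accumulator: [y] gathers the terms of weight [mu] met so far. *)
move=> Pc rw; suff select y : weight mu y -> P (y + \sum_(p <- r) p.2) ->
    P (y + \sum_(p <- r | perm_eq p.1 mu) p.2).
  move=> Pr; rewrite -[X in P X]add0r; apply: select; rewrite ?add0r //.
  by move=> i t t0; rewrite linear0 scaler0.
have [n] := ubnP (size r); elim: n r rw y => // n IHn [|p r] rw y.
  by rewrite !big_nil.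
rewrite ltnS /= => lt_rn wy.
have wp : weight p.1 p.2 by apply: rw; rewrite mem_head.
have {}rw : {in r, forall p, weight p.1 p.2} by move=> q qr; apply: rw; rewrite inE qr orbT.
rewrite !big_cons; case: ifPn => [pmu|/weight_separates[i [t [t0 ti]]]].
  rewrite !addrA; apply: IHn => // j t t0.
  by rewrite linearD /= wy (weight_perm pmu wp) scalerDr.
(* A step separating [p.1] from [mu] kills the term [p], fixes [y] and the terms of weight [mu], and
   rescales the other terms. *)
move=> /(Pc i t t0 _ _ ti); have sl := weight_step_linear mu i t0 (t ^+ count_mem i p.1).
have c0 : t ^+ count_mem i mu - t ^+ count_mem i p.1 != 0 by rewrite subr_eq0 eq_sym.
rewrite !(linD sl) (lin_sum sl) (weight_stepE _ _ _ _ wy) mulVf // scale1r.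
rewrite (weight_stepE _ _ _ _ wp) subrr mulr0 scale0r add0r => Pr.
pose r' := [seq (q.1, weight_step mu i t0 (t ^+ count_mem i p.1) q.2) | q <- r].
have := IHn r' _ y _ wy; rewrite !big_map => {}IHn.
suff -> : \sum_(q <- r | perm_eq q.1 mu) q.2 = \sum_(q <- r | perm_eq q.1 mu)
    weight_step mu i t0 (t ^+ count_mem i p.1) q.2.
  apply: IHn => //; last by rewrite size_map.
  move=> _ /mapP[q qr ->] /=; rewrite (weight_stepE _ _ _ _ (rw _ qr)).
  exact/weightZ/rw.
rewrite big_seq_cond [RHS]big_seq_cond; apply: eq_bigr => q /andP[qr qmu].
by rewrite (weight_stepE _ _ _ _ (weight_perm qmu (rw _ qr))) mulVf ?scale1r.
Qed.

(** The component of the weight of the first term lies in [U] by [weight_select]; subtracting it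
    leaves a shorter sum in [U]. *)
Lemma subrep_weighted_sum (U : M -> Prop) u :
  is_subrep rho U -> weighted_sum weight u -> U u ->
  weighted_sum (fun s x => U x /\ weight s x) u.
Proof.
move=> Usub [r rw ->]; have [U0 Ulin _] := Usub.
have [n] := ubnP (size r); elim: n r rw => // n IHn r rw lt_rn Ur.
case: r => [|p r] in rw lt_rn Ur *; first by exists [::].
have Up := weight_select (@step_closed_subrep p.1 _ Usub) rw Ur.
have Ur' := subspaceB Ulin Ur Up.
move: Ur'; rewrite [X in X - _](bigID (fun q => perm_eq q.1 p.1)) /= [X in X - _]addrC addrK.
rewrite -big_filter => /IHn[||r' rw' rE].
- by move=> q; rewrite mem_filter => /andP[_ /rw].
- rewrite /= perm_refl /=; apply: (@leq_ltn_trans (size r)) lt_rn.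
  by rewrite size_filter; apply: count_size.
exists ((p.1, \sum_(q <- p :: r | perm_eq q.1 p.1) q.2) :: r') => [q|].
  rewrite inE => /orP[/eqP -> /=|/rw' //]; split => // i t t0.
  rewrite linear_sum scaler_sumr big_seq_cond [RHS]big_seq_cond.
  by apply: eq_bigr => x /andP[/rw wx xp]; apply: (weight_perm xp wx).
have -> : \sum_(q <- (p.1, \sum_(q <- p :: r | perm_eq q.1 p.1) q.2) :: r') q.2 =
    \sum_(q <- p :: r | perm_eq q.1 p.1) q.2 + \sum_(q <- r') q.2 by apply: big_cons.
by rewrite -rE big_filter; apply: bigID.
Qed.

End Weights.

Lemma weight_one (k : fieldType) (A : comAlgType k) (rho : linrep (GL (Vinf k)) A) :
  is_algrep rho -> weight rho [::] 1.
Proof. by move=> rhoA i t t0; rewrite expr0 scale1r (rhoA _).1. Qed.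

Lemma weight_mul (k : fieldType) (A : comAlgType k) (rho : linrep (GL (Vinf k)) A)
    s s' a b : is_algrep rho ->
  weight rho s a -> weight rho s' b -> weight rho (s ++ s') (a * b).
Proof.
move=> rhoA wa wb i t t0; have [_ rM] := rhoA (torus i t0).
by rewrite rM wa wb -scalerAl -scalerAr scalerA count_cat exprD.
Qed.

Section TensorScaling.
Variables (k : fieldType) (M : lmodType k).

Lemma tens_scale n (c : 'I_n -> k) (v : n.-tuple M) :
  tens [tuple c i *: tnth v i | i < n] = (\prod_i c i) *: tens v.
Proof.
pose t m := [tuple if (i < m)%N then c i *: tnth v i else tnth v i | i < n].
have tE m : (m <= n)%N -> tens (t m) = (\prod_(i < n | (i < m)%N) c i) *: tens v.
  elim: m => [|m IHm] mn.
    rewrite big_pred0 // scale1r; congr tens.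
    by apply: eq_from_tnth => i; rewrite tnth_mktuple.
  pose i := Ordinal mn.
  have ti : tnth (t m) i = tnth v i by rewrite tnth_mktuple ltnn.
  have -> : t m.+1 = tset (t m) i (c i *: tnth (t m) i).
    apply: eq_from_tnth => j; rewrite ti !tnth_mktuple ltnS leq_eqVlt -(inj_eq val_inj) /=.
    by case: eqP => // /esym ji; have -> : j = i by apply: val_inj.
  have prodE : \prod_(j < n | (j < m.+1)%N) c j = c i * \prod_(j < n | (j < m)%N) c j.
    rewrite (bigD1 i) //=; congr (_ * _); apply: eq_bigl => j.
    by rewrite ltnS leq_eqVlt -(inj_eq val_inj) /=; case: ltngtP.
  apply: etrans (linZ (tens_multilinear (t m) i) _ _) _.
  by rewrite tset_id (IHm (ltnW mn)) scalerA -prodE.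
have -> : [tuple c i *: tnth v i | i < n] = t n.
  by apply: eq_from_tnth => i; rewrite !tnth_mktuple ltn_ord.
apply: etrans (tE n (leqnn n)) _; apply: (congr1 ( *:%R^~ (tens v))).
by apply: eq_bigl => i; rewrite ltn_ord.
Qed.

End TensorScaling.

Section BasisTensor.
Variable k : fieldType.
Local Notation V := (Vinf k).

Definition basis_tensor n (s : n.-tuple nat) : tpow V n := tens (map_tuple (ebase k) s).

Lemma basis_tensor_torus n (s : n.-tuple nat) i t (t0 : t != 0) :
  tpow_rep (std_rep V) n (torus i t0) (basis_tensor s) = t ^+ count_mem i s *: basis_tensor s.
Proof.
rewrite /basis_tensor tpow_repE.
have -> : count_mem i s = (\sum_(j < n) (tnth s j == i))%N.
  by rewrite -sum1_count big_mkcond big_tuple; apply: eq_bigr => j _ /=; case: eqP.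
have -> : t ^+ (\sum_(j < n) (tnth s j == i))%N = \prod_(j < n) t ^+ (tnth s j == i).
  by elim/big_rec2: _ => [|j y x _ <-]; rewrite ?expr0 ?exprD.
rewrite -tens_scale; congr tens; apply: eq_from_tnth => j.
by rewrite !tnth_map torusE tnth_ord_tuple.
Qed.

Lemma e_tensorE n : e_tensor k n = basis_tensor [tuple of iota 0 n].
Proof.
apply: (congr1 (@tens _ _ _)); apply: eq_from_tnth => i; rewrite tnth_mktuple tnth_map.
by rewrite (tnth_nth 0%N) nth_iota.
Qed.

Lemma schur_weight (M : lmodType k) (rho : linrep (GL V) M) n (f : schur rho n)
    (s : n.-tuple nat) : weight rho s (f (basis_tensor s)).
Proof.
move=> i t t0; rewrite -schur_equiv basis_tensor_torus.
exact: (linZ (schur_linear f)).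
Qed.

(** [schur_sub_base] applies to the difference of the two maps and the zero subrepresentation. *)
Lemma schur_basis_inj (M : lmodType k) (rho : linrep (GL V) M) n (f h : schur rho n)
    (s : n.-tuple nat) : uniq s -> f (basis_tensor s) = h (basis_tensor s) -> f = h.
Proof.
move=> s_uniq fh; have zero_rep : is_subrep rho (eq 0).
  split=> [//|a _ _ <- <-|g _ <-]; first by rewrite scaler0 addr0.
  by rewrite linear0.
have fhE x : ((-1) *: f + h : schur rho n) x = h x - f x.
  by rewrite -[LHS]/((-1) *: f x + h x) scaleN1r addrC.
have fh0 := @schur_sub_base _ _ _ _ _ ((-1) *: f + h) zero_rep s s_uniq.
apply: schur_ext => t; apply/esym/eqP; rewrite -subr_eq0 -fhE; apply/eqP/esym/fh0.
by rewrite fhE -[tens _]/(basis_tensor s) fh subrr.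
Qed.

End BasisTensor.

(** * Weight spaces of Sym(W (x) V) *)

Section WeightSpaces.
Variables (k : fieldType) (k_infinite : infinite_set [set: k]%classic) (W : lmodType k).
Local Notation V := (Vinf k).
Local Notation S := (symWV W).

Definition word_prod (l : seq (W * nat)) : S :=
  \prod_(p <- l) sym_in (tprod_in p.1 (ebase k p.2)).

Definition scaled_word (s : seq nat) (x : S) : Prop :=
  exists c l, [seq p.2 | p <- l] = s /\ x = c *: word_prod l.

Lemma scaled_wordZ s b x : scaled_word s x -> scaled_word s (b *: x).
Proof. by case=> c [l [ls ->]]; exists (b * c), l; rewrite scalerA. Qed.

Let sum_lin a u v : weighted_sum scaled_word u -> weighted_sum scaled_word v ->
  weighted_sum scaled_word (a *: u + v).
Proof. by apply: weighted_sum_lin => s b x; apply: scaled_wordZ. Qed.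

(** Expanding [x] into terms w (x) e_i prepends one letter to the word in each term. *)
Lemma mul_word (x : tprod W V) l : weighted_sum scaled_word (sym_in x * word_prod l).
Proof.
have sum0 : weighted_sum scaled_word 0 by exists [::]; rewrite ?big_nil.
have lin : linear (fun x : tprod W V => sym_in x * word_prod l).
  by move=> a u v; rewrite linearP; apply: alg_mul_linearl.
pose f (x : tprod W V) : S := sym_in x * word_prod l.
have {}lin : linear f by exact: lin.
rewrite -[_ * _]/(f x); elim/pres_ind: x => [|[w v]|a u v wu wv]; last 2 first.
- rewrite -[pgen _ _]/(tprod_in w v).
  have lv : linear (fun v => f (tprod_in w v)).
    by move=> a u u'; rewrite tprod_in_linearr lin.
  elim/Vinf_ind: v => [|i|a u u' wu wu']; last 2 first.
  + apply: (weighted_sum1 (s := i :: [seq p.2 | p <- l])).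
    exists 1, ((w, i) :: l); split=> //; rewrite scale1r /f /word_prod.
    by rewrite [RHS]big_cons.
  + by rewrite (lv a u u'); apply: sum_lin.
  by rewrite (lin0 lv).
- by rewrite lin; apply: sum_lin.
by rewrite (lin0 lin).
Qed.

Lemma word_span (u : S) : weighted_sum scaled_word u.
Proof.
elim/sym_ind: u => [|x u IHu|a u v IHu IHv]; last exact: sum_lin.
  apply: (weighted_sum1 (s := [::])); exists 1, [::]; split=> //.
  by rewrite scale1r /word_prod big_nil.
apply: (weighted_sum_map (alg_mul_linearr (sym_in x)) _ IHu) => s _ [c [l [_ ->]]].
rewrite (linZ (alg_mul_linearr (sym_in x))) -[_ *: _]addr0.
by apply: sum_lin; [apply: mul_word|exists [::]; rewrite ?big_nil].
Qed.

Lemma weight_gen w i : weight (symWV_GL W) [:: i] (sym_in (tprod_in w (ebase k i))).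
Proof.
move=> j t t0; apply: etrans (sym_rep_in _ _ _) _.
rewrite -(linZ (sym_in_tprodr w)); congr sym_in.
by apply: etrans (tprodr_funE _ _ _ _) _; rewrite torusE /= addn0.
Qed.

Lemma weight_word l : weight (symWV_GL W) [seq p.2 | p <- l] (word_prod l).
Proof.
have GL_alg : is_algrep (symWV_GL W) := sym_rep_alg (tprodr_rep W (std_rep V)).
elim: l => [|p l IHl].
  by have -> : word_prod [::] = 1 := big_nil _ _ _ _; apply: (weight_one GL_alg).
have -> : word_prod (p :: l) = sym_in (tprod_in p.1 (ebase k p.2)) * word_prod l.
  exact: big_cons.
exact: (weight_mul GL_alg (weight_gen p.1 p.2) IHl).
Qed.

Lemma weight_span (u : S) : weighted_sum (weight (symWV_GL W)) u.
Proof.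
have [r rP ->] := word_span u; exists r => // p /rP[c [l [<- ->]]].
exact/weightZ/weight_word.
Qed.

(** Commutativity of [S] lets the letters be listed in the order prescribed by [s]. *)
Lemma word_pair n (s : n.-tuple nat) l : perm_eq [seq p.2 | p <- l] s ->
  exists x : tpow W n, word_prod l = tpow_pair x (basis_tensor k s).
Proof.
move=> ls; have ln : size l = n by rewrite -(size_map snd) (perm_size ls) size_tuple.
pose lt : n.-tuple (W * nat) := tcast ln (in_tuple l).
have lE : l = lt by rewrite val_tcast.
have /tuple_permP[p pE] : perm_eq s (map_tuple snd lt) by rewrite perm_sym /= -lE.
have sE i : tnth s i = (tnth lt (p i)).2.
  have -> : s = [tuple tnth (map_tuple snd lt) (p i) | i < n] by apply: val_inj.
  by rewrite tnth_mktuple tnth_map.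
exists (tens [tuple (tnth lt (p i)).1 | i < n]).
rewrite /basis_tensor tpow_pairE pair_prod.unlock /word_prod lE big_tuple.
have E (F H : 'I_n -> S) : (forall i, F (p i) = H i) -> \prod_i F i = \prod_i H i.
  by move=> FH; rewrite (reindex_inj (@perm_inj _ p)); apply: eq_bigr => i _.
by apply: E => i; rewrite tnth_mktuple tnth_map sE.
Qed.

(** Words span [S], and since [u] has weight [s], it equals the partial sum over the words whose
    indices rearrange [s]. *)
Lemma weight_space n (s : n.-tuple nat) (u : S) : weight (symWV_GL W) s u ->
  exists x : tpow W n, u = tpow_pair x (basis_tensor k s).
Proof.
move=> wu; have [r rP uE] := word_span u.
have rw : {in r, forall p, weight (symWV_GL W) p.1 p.2}.
  by move=> p /rP[c [l [<- ->]]]; apply/weightZ/weight_word.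
have -> := weight_select k_infinite (step_closed_weight wu) rw uE.
have lp := tpow_pair_linearl (W := W) (basis_tensor k s).
apply: (@subspace_sum _ _ (fun u => exists x, u = tpow_pair x (basis_tensor k s))).
- by exists 0; rewrite (lin0 lp).
- by move=> a _ _ [x ->] [y ->]; exists (a *: x + y); rewrite lp.
move=> p /rP[c [l [<- ->]]] /word_pair[x ->].
by exists (c *: x); rewrite (linZ lp).
Qed.

End WeightSpaces.

(** * The identification and generation *)

Section Identification.
Variables (k : fieldType) (k_infinite : infinite_set [set: k]%classic) (W : lmodType k).
Local Notation V := (Vinf k).
Local Notation S := (symWV W).

Definition schur_tens n (f : schur (symWV_GL W) n) : tpow W n :=
  weight_coord n (f (e_tensor k n)).

Lemma schur_tens_linear n : linear (@schur_tens n).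
Proof. by move=> a f h; rewrite /schur_tens schur_linE weight_coord_linear. Qed.

Lemma schur_ofK n : cancel (@schur_of k W n) (@schur_tens n).
Proof. exact: weight_coord_pair. Qed.

(** By [weight_space] the value of [f] at e_1 ... e_n is that of some [schur_of x], and this value
    determines [f]. *)
Lemma schur_tensK n : cancel (@schur_tens n) (@schur_of k W n).
Proof.
move=> f; pose s : n.-tuple nat := [tuple of iota 0 n].
have [x fx] := weight_space k_infinite (schur_weight f s).
have fe : f (e_tensor k n) = schur_of x (e_tensor k n).
  by rewrite e_tensorE fx.
have -> : schur_tens f = x.
  by rewrite /schur_tens fe; exact: schur_ofK.
apply: (schur_basis_inj (iota_uniq 0 n)).
by symmetry; rewrite -[_ (basis_tensor k _)]/(f (basis_tensor k s)) fx.
Qed.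

Lemma schur_tens_iso : @tca_iso k (schur_symWV W) (tensor_tca W) schur_tens.
Proof.
split=> [n|n|n s f||m n f h].
- exact: schur_tens_linear.
- by exists (@schur_of k W n); [apply: schur_tensK|apply: schur_ofK].
- by rewrite -{1}[f]schur_tensK -[tca_act _ s _]schur_of_act; apply: schur_ofK.
- by rewrite -schur_of_one; apply: schur_ofK.
by rewrite -{1}[f]schur_tensK -{1}[h]schur_tensK -[tca_mul _ _ _]schur_of_mul; apply: schur_ofK.
Qed.

Lemma schur_tens_vector n (f : schur (symWV_GL W) n) w :
  schur_tens f = tens w <-> f (e_tensor k n) = weight_vector w.
Proof.
split=> [fw|fw]; last by rewrite /schur_tens fw weight_coord_vector.
by rewrite -(schur_tensK f) fw; exact: tpow_pair_e.
Qed.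

(** [tpow_pair] commutes with [G], and a tensor is recovered from its value at e_1 ... e_n, so
    invariance of that value already gives invariance of the tensor. *)
Lemma schur_tens_invariant (G : groupType) (rho : linrep G W) n (f : schur (symWV_GL W) n) :
  schur_sub (invariants (symWV_G rho)) f <-> invariants (tpow_rep rho n) (schur_tens f).
Proof.
rewrite -{1}(schur_tensK f); move: (schur_tens f) => x; split=> [xG g|xG y g].
  rewrite -[LHS]weight_coord_pair tpow_pair_G.
  apply: etrans (weight_coord_pair x); congr weight_coord.
  exact: (xG (e_tensor k n) g).
by apply: etrans (esym (tpow_pair_G _ _ _ _)) _; rewrite xG.
Qed.

End Identification.

Section TensorInvariants.
Variables (k : fieldType) (W : lmodType k) (G : groupType) (rho : linrep G W).

Lemma tpow_rep_act n g (s : 'S_n) (x : tpow W n) :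
  tpow_rep rho n g (tpow_act s x) = tpow_act s (tpow_rep rho n g x).
Proof.
apply: (@tpow_ext _ _ _ _ (fun x => tpow_rep rho n g (tpow_act s x))
  (fun x => tpow_act s (tpow_rep rho n g x))) => [a u v|a u v|t].
- by rewrite tpow_act_linear rep_linear.
- by rewrite rep_linear tpow_act_linear.
rewrite tpow_actE !tpow_repE tpow_actE; apply: (congr1 (@tens _ _ _)).
by apply: eq_from_tnth => i; rewrite tnth_map !tnth_mktuple tnth_map.
Qed.

Lemma tpow_rep_mul m n g (x : tpow W m) (y : tpow W n) :
  tpow_rep rho (m + n) g (tpow_mul x y) = tpow_mul (tpow_rep rho m g x) (tpow_rep rho n g y).
Proof.
apply: (@tpow_ext _ _ _ _ (fun x => tpow_rep rho (m + n) g (tpow_mul x y))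
  (fun x => tpow_mul (tpow_rep rho m g x) (tpow_rep rho n g y))) => [a u v|a u v|t].
- by rewrite tpow_mul_linearl rep_linear.
- by rewrite rep_linear tpow_mul_linearl.
apply: (@tpow_ext _ _ _ _ (fun y => tpow_rep rho (m + n) g (tpow_mul (tens t) y))
  (fun y => tpow_mul (tpow_rep rho m g (tens t)) (tpow_rep rho n g y))) => [a u v|a u v|t'].
- by rewrite tpow_mul_linearr rep_linear.
- by rewrite rep_linear tpow_mul_linearr.
rewrite tpow_mulE !tpow_repE tpow_mulE; apply: (congr1 (@tens _ _ _)).
apply: val_inj; exact: map_cat.
Qed.

(** The easy inclusion of (2): [G] acts by automorphisms of the tca. *)
Lemma tca_gen_invariant (X : forall n, tpow W n -> Prop) :
  (forall n (x : tpow W n), X n x -> invariants (tpow_rep rho n) x) ->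
  forall n (x : tpow W n), tca_gen (A := tensor_tca W) X x -> invariants (tpow_rep rho n) x.
Proof.
move=> XG n x; elim=> {n x} [n x /XG //||n|n a x y _ xG _ yG|m n x y _ xG _ yG|n s x _ xG] g.
- by apply: etrans (tpow_repE _ _ _) _; apply: (congr1 (@tens _ _ _)); apply: val_inj.
- exact: linear0.
- by apply: etrans (rep_linear _ _ _ _ _) _; rewrite xG yG.
- by apply: etrans (tpow_rep_mul _ _ _) _; rewrite xG yG.
by apply: etrans (tpow_rep_act _ _ _) _; rewrite xG.
Qed.

End TensorInvariants.

(** * Generation of the invariant tensors *)

Section Generation.
Variables (k : fieldType) (k_infinite : infinite_set [set: k]%classic) (W : lmodType k).
Local Notation V := (Vinf k).
Local Notation S := (symWV W).
Variable U : S -> Prop.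
Hypothesis Usub : is_subrep (symWV_GL W) U.

Definition schur_gens n (y : tensor_tca W n) : Prop :=
  exists2 f : schur (symWV_GL W) n, schur_sub U f & schur_tens f = y.

Local Notation tgen := (@tca_gen k (tensor_tca W) schur_gens _).

Lemma tgenZ n a (x : tpow W n) : tgen x -> tgen (a *: x).
Proof.
move=> gx; have := tca_gen_lin a gx (tca_gen_0 (A := tensor_tca W) schur_gens n).
by rewrite addr0.
Qed.

(* a weight vector of squarefree weight s is a value at e_s of an element of S(S)
   identified with an element of the tca generated by S(U) *)
Definition gen_piece (s : seq nat) (a : S) : Prop :=
  weight (symWV_GL W) s a /\
  (uniq s -> exists n (t : n.-tuple nat) (x : tpow W n),
    [/\ tval t = s, tgen x & a = tpow_pair x (basis_tensor k t)]).

Lemma gen_pieceZ s b a : gen_piece s a -> gen_piece s (b *: a).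
Proof.
case=> wa ga; split=> [|/ga[n [t [x [ts gx ->]]]]]; first exact: weightZ.
exists n, t, (b *: x); split=> //; first exact: tgenZ.
by rewrite (linZ (tpow_pair_linearl (basis_tensor k t))).
Qed.

(** If the concatenated weight is squarefree, so are both factors; the tca product of their tensors
    then has value [a * b] at the concatenated basis tensor. *)
Lemma gen_pieceM s s' a b : gen_piece s a -> gen_piece s' b -> gen_piece (s ++ s') (a * b).
Proof.
have GL_alg : is_algrep (symWV_GL W) := sym_rep_alg (tprodr_rep W (std_rep V)).
case=> wa ga [wb gb]; split; first exact: (weight_mul GL_alg wa wb).
rewrite cat_uniq => /and3P[us _ us'].
have [[n [t [x [<- gx ->]]]] [m [t' [y [<- gy ->]]]]] := conj (ga us) (gb us').
exists (n + m)%N, (cat_tuple t t'), (tpow_mul x y); split=> //.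
  exact: (tca_gen_mul (A := tensor_tca W) gx gy).
rewrite -tpow_pair_mul; apply: (congr1 (fun v => tpow_pair (tpow_mul x y) (tens v))).
by apply: val_inj; rewrite /= map_cat.
Qed.

(** Write [a] as the value of some [schur_of x] at e_s. As this one value lies in [U], so do all
    others, and [x] comes from S(U). *)
Lemma gen_piece_sub s a : U a -> weight (symWV_GL W) s a -> gen_piece s a.
Proof.
move=> Ua wa; split=> // s_uniq; exists (size s), (in_tuple s).
have [x xE] := weight_space k_infinite (wa : weight (symWV_GL W) (in_tuple s) a).
exists x; split=> //; apply: tca_gen_in; exists (schur_of x); last exact: schur_ofK.
apply: (schur_sub_base Usub (s := in_tuple s)) => //.
by rewrite schur_ofE -[tens _]/(basis_tensor k (in_tuple s)) -xE.
Qed.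

Lemma alg_gen_pieces a : alg_gen U a -> weighted_sum gen_piece a.
Proof.
elim=> {a} [a Ua||b x y _ IHx _ IHy|x y _ IHx _ IHy].
- have := subrep_weighted_sum k_infinite Usub (weight_span a) Ua.
  apply: (weighted_sum_map (f := id)) => // s x [Ux wx].
  exact: (weighted_sum1 (gen_piece_sub Ux wx)).
- apply: (weighted_sum1 (s := [::])); split=> [|_].
    exact: (weight_one (sym_rep_alg (tprodr_rep W (std_rep V)))).
  exists 0%N, [tuple], (tens [tuple]); split=> //; first exact: tca_gen_one.
  by apply/esym; apply: etrans (tpow_pairE _ _) _; rewrite pair_prod.unlock; apply: big_ord0.
- exact: (weighted_sum_lin b gen_pieceZ).
apply: (weighted_sum_map (alg_mul_linearl y) _ IHx) => s x' px.
apply: (weighted_sum_map (alg_mul_linearr x') _ IHy) => s' y' py.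
exact: (weighted_sum1 (gen_pieceM px py)).
Qed.

(** The symmetric group action rearranges e_s into e_1 ... e_n. *)
Lemma perm_piece n (s : seq nat) a : perm_eq s (iota 0 n) -> gen_piece s a ->
  exists2 z : tpow W n, tgen z & a = tpow_pair z (e_tensor k n).
Proof.
move=> sn [_]; case; first by rewrite (perm_uniq sn) iota_uniq.
move=> m [t [x [ts gx ->]]].
have mn : m = n by rewrite -(size_tuple t) ts (perm_size sn) size_iota.
move: t x ts gx; rewrite mn => t x ts gx.
pose I : n.-tuple nat := [tuple of iota 0 n].
have /tuple_permP[p pE] : perm_eq t I by rewrite ts.
exists (tpow_act p x); first exact: (tca_gen_act (A := tensor_tca W) p gx).
rewrite e_tensorE /basis_tensor tpow_pair_act.
apply: (congr1 (fun v => tpow_pair x (tens v))); apply: eq_from_tnth => i.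
have -> : t = [tuple tnth I (p i) | i < n] by apply: val_inj.
by rewrite tnth_map !tnth_mktuple tnth_map.
Qed.

(** Only pieces of weight (1^n) contribute to the value at e_1 ... e_n; their weights are
    squarefree, so each comes from the generated tca. *)
Lemma alg_gen_tgen n (y : tpow W n) : alg_gen U (tpow_pair y (e_tensor k n)) -> tgen y.
Proof.
pose I : n.-tuple nat := [tuple of iota 0 n].
move=> /alg_gen_pieces[r rP uE].
have wu : weight (symWV_GL W) (iota 0 n) (tpow_pair y (e_tensor k n)).
  rewrite e_tensorE; exact: (schur_weight (schur_of y) I).
have rw : {in r, forall p, weight (symWV_GL W) p.1 p.2} by move=> p /rP[].
have uE' := weight_select k_infinite (step_closed_weight wu) rw uE.
suff [z gz zE] : exists2 z : tpow W n, tgen z &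
    \sum_(p <- r | perm_eq p.1 (iota 0 n)) p.2 = tpow_pair z (e_tensor k n).
  (* [y] and [z] have the same value at e_1 ... e_n, hence coincide. *)
  by rewrite -(weight_coord_pair y) uE' zE weight_coord_pair.
have lp := tpow_pair_linearl (W := W) (e_tensor k n).
apply: (@subspace_sum _ _ (fun u => exists2 z, tgen z & u = tpow_pair z (e_tensor k n))).
- by exists 0; [exact: tca_gen_0|rewrite (lin0 lp)].
- move=> a _ _ [x gx ->] [x' gx' ->]; exists (a *: x + x'); last by rewrite lp.
  exact: tca_gen_lin.
by move=> p /rP pP pn; apply: perm_piece pn pP.
Qed.

End Generation.

Theorem theorem1p2 (k : fieldType) (k_infinite : infinite_set [set: k]%classic)
    (G : groupType) (W : lmodType k) (rho : linrep G W) :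
  exists phi : forall n, schur_symWV W n -> tensor_tca W n,
    [/\ (* phi is the identification of S(S) with R *)
        tca_iso phi,
        forall n (f : schur (symWV_GL W) n) (w : n.-tuple W),
          phi n f = tens w <-> f (e_tensor k n) = weight_vector w,
        (* (1) *)
        forall n (f : schur (symWV_GL W) n),
          schur_sub (invariants (symWV_G rho)) f <->
          invariants (tpow_rep rho n) (phi n f)
      & (* (2) *)
        forall U : symWV W -> Prop,
          is_subrep (symWV_GL W) U ->
          (forall x, U x -> invariants (symWV_G rho) x) ->
          (forall x, alg_gen U x <-> invariants (symWV_G rho) x) ->
          let SU n (y : tensor_tca W n) :=
            exists2 f : schur (symWV_GL W) n, schur_sub U f & phi n f = y in
          forall n (y : tensor_tca W n),
            tca_gen SU y <-> invariants (tpow_rep rho n) y].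
Proof.
exists (@schur_tens k W); split.
- exact: schur_tens_iso.
- exact: schur_tens_vector.
- exact: schur_tens_invariant.
move=> U Usub UG Ugen SU n y; split.
  apply: tca_gen_invariant => {n y} n y [f Uf <-].
  by apply/schur_tens_invariant => // x; apply/UG/Uf.
(* It remains to see that the value at e_1 ... e_n lies in the algebra generated by [U], that is,
   that it is invariant. *)
move=> yG; apply: (alg_gen_tgen k_infinite Usub); apply/Ugen => g.
by rewrite -tpow_pair_G yG.
Qed.
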